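(* Let $X$ be a real Banach space and $G$ a topological group satisfying condition $(G_0)$ stated in the context. Let $I=\Phi+\Psi:X\to(-\infty,\infty]$ with $\Phi\in C^1(X,\mathbb{R})$ and $\Psi:X\to(-\infty,\infty]$ convex, lower semicontinuous and $\Psi\not\equiv\infty$. Suppose that $I$ satisfies the Palais-Smale condition, and that $\Phi$ and $\Psi$ are $G$-invariant functionals with $\Psi$ compatible with the action of $G$ on $X$. For each $k$ let $\rho_k>r_k>0$ and set $$Y_k:=\bigoplus_{j=1}^kX_j,\qquad Z_k:=\overline{\bigoplus_{j=k}^\infty X_j},\qquad B_k:=\{u\in Y_k:\|u\|\le\rho_k\}.$$ Assume that, for every $k\ge2$, i) $a_k:=\sup_{u\in Y_k,\ \|u\|=\rho_k}I(u)\le0$; ii) $b_k:=\inf_{u\in Z_k,\ \|u\|=r_k}I(u)\to\infty$ (as $k\to\infty$). Suppose also that the levels $$c_k:=\inf_{\gamma\in\Theta_k}\ \sup_{u\in B_k}I(\gamma(u))$$ satisfy $c_k<\infty$, where $$\Theta_k:=\{\gamma\in C(B_k,X):\ \gamma \text{ is equivariant and } \gamma|_{\partial B_k}\equiv \mathrm{Id}|_{\partial B_k}\}.$$ Then $I$ has infinitely many critical points $\{u_k\}$ such that $I(u_k)=c_k\to\infty$.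
   Context: A point $u\in X$ is a critical point of $I=\Phi+\Psi$ if $I(u)<\infty$ and $\langle\Phi'(u),v-u\rangle+\Psi(v)-\Psi(u)\ge 0$ for all $v\in X$. A Palais-Smale sequence for $I$ at level $c$ is a sequence $(u_n)$ with $I(u_n)\to c$ and, for some $\varepsilon_n\to0^+$, $\langle\Phi'(u_n),v-u_n\rangle+\Psi(v)-\Psi(u_n)\ge-\varepsilon_n\|v-u_n\|$ for all $v\in X$. $I$ satisfies the Palais-Smale condition if, for every level $c\in\mathbb{R}$, each Palais-Smale sequence at level $c$ has a convergent subsequence. An action of $G$ on $X$ is a continuous map $G\times X\to X$, $(g,v)\mapsto gv$, with $ev=v$, $(gh)v=g(hv)$, and $v\mapsto gv$ linear for each $g$; it is isometric if $\|gv\|=\|v\|$ for all $g,v$. A set $A\subset X$ is $G$-invariant if $gA=A$ for every $g\in G$; a map $\gamma:A\to X$ on a $G$-invariant set is equivariant if $\gamma(gx)=g\gamma(x)$ for all $x\in A$, $g\in G$; a functional $\varphi$ is $G$-invariant if $\varphi(gx)=\varphi(x)$ for all $x,g$. Admissibility: let $V$ be a finite dimensional vector space on which the compact group $G$ acts, and let $G$ act diagonally on $V^k$, $g(v_1,\dots,v_k)=(gv_1,\dots,gv_k)$. The action of $G$ on $V$ is admissible if for each $k\ge2$, each bounded $G$-invariant open set $U\subset V^k$ with $0\in U$, and each continuous equivariant map $\gamma:\partial U\to V^{k-1}$, there is $u\in\partial U$ with $\gamma(u)=0$. Condition $(G_0)$: $G$ is a compact group that acts isometrically on $X=\overline{\bigoplus_{j\in\mathbb{N}}X_j}$,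 where every $X_j$ is a $G$-invariant subspace of $X$ such that $X_j\cong V$, with $V$ a finite dimensional vector space for which the action of $G$ is admissible. Compatibility: let $\mu$ be the normalized Haar measure on $G$ ($\mu(G)=1$); integrals of $X$-valued functions are Bochner integrals. $\Psi$ is compatible with the action of $G$ on $X$ if $\Psi\left(\int_G\beta(gu)\,d\mu\right)\le\int_G\Psi(\beta(gu))\,d\mu$ for every $u\in X$ and every $\beta\in C(Gu,X)$, where $Gu:=\{gu:g\in G\}$. Here $\partial B_k=\{u\in Y_k:\|u\|=\rho_k\}$. *)

(* Defs.v *)
From HB Require Import structures.
From mathcomp Require Import all_boot all_order all_algebra.
From mathcomp Require Import all_classical all_reals all_analysis.

Set Implicit Arguments.
Unset Strict Implicit.
Unset Printing Implicit Defensive.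

Import Order.TTheory GRing.Theory Num.Theory.
Import numFieldNormedType.Exports.

Local Open Scope classical_set_scope.
Local Open Scope ring_scope.

(* Pointedness costs no generality, since a group is inhabited; it is required
   by [g_sigma_algebraType].  No separation axiom is imposed. *)
HB.mixin Record isTopologicalGroup (G : Type)
    of Group G & PointedTopological G := {
  mulg_continuous : continuous (fun p : G * G => (p.1 * p.2)%g) ;
  invg_continuous : continuous (fun x : G => (x^-1)%g)
}.

#[short(type="topologicalGroupType")]
HB.structure Definition TopologicalGroup :=
  {G of Group G & PointedTopological G & isTopologicalGroup G}.

Definition borel (T : ptopologicalType) := g_sigma_algebraType (@open T).

(* Left invariance and outer regularity, the normalization mu(G) = 1 being part
   of [probability]; regularity makes mu unique when G is not metrizable. *)
Definition is_haar (R : realType) (G : topologicalGroupType)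
    (mu : probability (borel G) R) : Prop :=
  (forall (g : G) (A : set (borel G)), measurable A ->
     mu [set (g * x)%g | x in (A : set G)] = mu A) /\
  (forall A : set (borel G), measurable A ->
     mu A = ereal_inf
       [set mu U | U in [set U : set (borel G) | @open G U /\ A `<=` U]]).

Definition simple_function (R : realType) (X : normedModType R)
    (G : topologicalGroupType) (s : borel G -> X) : Prop :=
  finite_set (range s) /\ forall x : X, measurable (s @^-1` [set x]).

Definition simple_integral (R : realType) (X : normedModType R)
    (G : topologicalGroupType) (mu : probability (borel G) R)
    (s : borel G -> X) : X :=
  \sum_(x \in range s) fine (mu (s @^-1` [set x])) *: x.

(* The integrand [`|f g - s n g|] is a.e. equal to a Borel function but need not
   be Borel itself; [\int[mu]], a supremum over simple minorants, has the same
   value on both. *)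
Definition is_bochner_integral (R : realType) (X : normedModType R)
    (G : topologicalGroupType) (mu : probability (borel G) R)
    (f : borel G -> X) (v : X) : Prop :=
  exists s : nat -> borel G -> X,
    [/\ forall n, simple_function (s n),
        {ae mu, forall g, s n g @[n --> \oo] --> f g},
        (\int[mu]_g `|f g - s n g|%R%:E)%E @[n --> \oo] --> 0%E &
        simple_integral mu (s n) @[n --> \oo] --> v].

(* Junk value 0 when [f] is not Bochner integrable. *)
Definition bochner_integral (R : realType) (X : normedModType R)
    (G : topologicalGroupType) (mu : probability (borel G) R)
    (f : borel G -> X) : X :=
  xget 0 (is_bochner_integral mu f).

Definition is_action (R : realType) (X : normedModType R)
    (G : topologicalGroupType) (act : G -> X -> X) : Prop :=
  [/\ continuous (fun p : G * X => act p.1 p.2),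
      forall v, act 1%g v = v,
      forall g h v, act (g * h)%g v = act g (act h v) &
      forall g (a : R) v w, act g (a *: v + w) = a *: act g v + act g w].

Definition isometric_action (R : realType) (X : normedModType R)
    (G : topologicalGroupType) (act : G -> X -> X) : Prop :=
  forall g v, `|act g v| = `|v|.

Definition invariant_set (G T : Type) (act : G -> T -> T) (A : set T) : Prop :=
  forall g, [set act g x | x in A] = A.

Definition equivariant_on (G T T' : Type) (act : G -> T -> T)
    (act' : G -> T' -> T') (A : set T) (f : T -> T') : Prop :=
  forall g x, A x -> f (act g x) = act' g (f x).

Definition invariant_functional (G T S : Type) (act : G -> T -> T)
    (f : T -> S) : Prop :=
  forall g x, f (act g x) = f x.

Definition orbit_of (G T : Type) (act : G -> T -> T) (u : T) : set T :=
  [set act g u | g in [set: G]].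

Definition boundary (T : topologicalType) (U : set T) : set T :=
  closure U `\` U°.

Definition finite_dimensional (R : realType) (V : normedModType R) : Prop :=
  exists (n : nat) (e : 'I_n -> V), forall v : V,
    exists a : 'I_n -> R, v = \sum_(i < n) a i *: e i.

(* V^k is ['rV[V]_k], whose topology is the product topology. *)
Definition diagonal_action (R : realType) (V : normedModType R)
    (G : topologicalGroupType) (act : G -> V -> V) (k : nat) (g : G)
    (v : 'rV[V]_k) : 'rV[V]_k :=
  map_mx (act g) v.

Definition admissible (R : realType) (V : normedModType R)
    (G : topologicalGroupType) (act : G -> V -> V) : Prop :=
  forall k : nat, (2 <= k)%N ->
  forall U : set 'rV[V]_k,
    (exists M : R, forall v, U v -> forall i, `|v ord0 i| <= M) ->
    invariant_set (diagonal_action act (k := k)) U -> open U -> U 0 ->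
  forall gamma : 'rV[V]_k -> 'rV[V]_k.-1,
    {within boundary U, continuous gamma} ->
    equivariant_on (diagonal_action act (k := k))
      (diagonal_action act (k := k.-1)) (boundary U) gamma ->
  exists2 u, boundary U u & gamma u = 0.

Definition is_subspace (R : realType) (X : normedModType R) (A : set X) : Prop :=
  A 0 /\ forall (a : R) x y, A x -> A y -> A (a *: x + y).

(* Algebraic sum of the X_j with P j, not closed. *)
Definition sum_of (R : realType) (X : normedModType R) (Xs : nat -> set X)
    (P : pred nat) : set X :=
  [set u | exists (n : nat) (x : nat -> X),
     (forall j, P j -> Xs j (x j)) /\ u = \sum_(0 <= j < n | P j) x j].

(* The family is indexed by j >= 1; [Xs 0] plays no role. *)
Definition independent_family (R : realType) (X : normedModType R)
    (Xs : nat -> set X) : Prop :=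
  forall (n : nat) (x : nat -> X), (forall j, (1 <= j)%N -> Xs j (x j)) ->
    \sum_(1 <= j < n) x j = 0 -> forall j, (1 <= j < n)%N -> x j = 0.

(* X_j and V are isomorphic as representations of G. *)
Definition G_isomorphic (R : realType) (X V : normedModType R)
    (G : topologicalGroupType) (act : G -> X -> X) (actV : G -> V -> V)
    (A : set X) : Prop :=
  exists f : {linear V -> X},
    [/\ injective f, range f = A & equivariant_on actV act [set: V] f].

Definition condition_G0 (R : realType) (X : normedModType R)
    (G : topologicalGroupType) (act : G -> X -> X) (Xs : nat -> set X) : Prop :=
  [/\ compact [set: G], is_action act, isometric_action act,
      independent_family Xs /\
        closure (sum_of Xs (fun j => (1 <= j)%N)) = [set: X] &
      (forall j, (1 <= j)%N -> is_subspace (Xs j) /\ invariant_set act (Xs j)) /\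
      exists (V : normedModType R) (actV : G -> V -> V),
        [/\ finite_dimensional V, is_action actV, admissible actV &
            forall j, (1 <= j)%N -> G_isomorphic act actV (Xs j)]].

Definition compatible (R : realType) (X : normedModType R)
    (G : topologicalGroupType) (mu : probability (borel G) R)
    (act : G -> X -> X) (Psi : X -> \bar R) : Prop :=
  forall (u : X) (beta : X -> X),
    {within orbit_of act u, continuous beta} ->
    (Psi (bochner_integral mu (fun g => beta (act g u)))
       <= \int[mu]_g Psi (beta (act g u)))%E.

(* The last clause is continuity of the derivative in the operator norm. *)
Definition C1_functional (R : realType) (X : normedModType R)
    (Phi : X -> R) : Prop :=
  (forall u, differentiable Phi u) /\
  forall u (e : R), 0 < e -> \forall w \near u, forall h,
    `|'d Phi w h - 'd Phi u h| <= e * `|h|.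

Definition ereal_convex (R : realType) (X : normedModType R)
    (Psi : X -> \bar R) : Prop :=
  forall (x y : X) (t : R), 0 <= t <= 1 ->
    (Psi (t *: x + (1 - t) *: y)%R <= t%:E * Psi x + (1 - t)%R%:E * Psi y)%E.

Definition functional (R : realType) (X : normedModType R)
    (Phi : X -> R) (Psi : X -> \bar R) (u : X) : \bar R :=
  ((Phi u)%:E + Psi u)%E.

Definition critical_point (R : realType) (X : normedModType R)
    (Phi : X -> R) (Psi : X -> \bar R) (u : X) : Prop :=
  (functional Phi Psi u < +oo)%E /\
  forall v, (0 <= ('d Phi u (v - u)%R)%:E + Psi v - Psi u)%E.

(* Since +oo - +oo = -oo in [\bar R], the inequality at v = u forces
   Psi (u n) < +oo. *)
Definition Palais_Smale_sequence (R : realType) (X : normedModType R)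
    (Phi : X -> R) (Psi : X -> \bar R) (c : R) (u : nat -> X) : Prop :=
  functional Phi Psi (u n) @[n --> \oo] --> c%:E /\
  exists eps : nat -> R,
    [/\ forall n, 0 < eps n, eps n @[n --> \oo] --> (0 : R) &
        forall n v, ((- (eps n * `|v - u n|))%R%:E
          <= ('d Phi (u n) (v - u n)%R)%:E + Psi v - Psi (u n))%E].

Definition Palais_Smale_condition (R : realType) (X : normedModType R)
    (Phi : X -> R) (Psi : X -> \bar R) : Prop :=
  forall (c : R) (u : nat -> X), Palais_Smale_sequence Phi Psi c u ->
  exists phi : nat -> nat,
    {homo phi : m n / (m < n)%N} /\ cvg (u (phi n) @[n --> \oo]).

Definition Y_ (R : realType) (X : normedModType R) (Xs : nat -> set X)
    (k : nat) : set X :=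
  sum_of Xs (fun j => (1 <= j <= k)%N).

Definition Z_ (R : realType) (X : normedModType R) (Xs : nat -> set X)
    (k : nat) : set X :=
  closure (sum_of Xs (fun j => (k <= j)%N)).

Definition B_ (R : realType) (X : normedModType R) (Xs : nat -> set X)
    (rho : nat -> R) (k : nat) : set X :=
  [set u | Y_ Xs k u /\ `|u| <= rho k].

Definition dB_ (R : realType) (X : normedModType R) (Xs : nat -> set X)
    (rho : nat -> R) (k : nat) : set X :=
  [set u | Y_ Xs k u /\ `|u| = rho k].

Definition a_ (R : realType) (X : normedModType R) (Xs : nat -> set X)
    (rho : nat -> R) (I : X -> \bar R) (k : nat) : \bar R :=
  ereal_sup [set I u | u in [set u | Y_ Xs k u /\ `|u| = rho k]].

Definition b_ (R : realType) (X : normedModType R) (Xs : nat -> set X)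
    (r : nat -> R) (I : X -> \bar R) (k : nat) : \bar R :=
  ereal_inf [set I u | u in [set u | Z_ Xs k u /\ `|u| = r k]].

(* Maps on B_k are represented by total functions on X; only their values on
   B_k matter. *)
Definition Theta_ (R : realType) (X : normedModType R)
    (G : topologicalGroupType) (act : G -> X -> X) (Xs : nat -> set X)
    (rho : nat -> R) (k : nat) : set (X -> X) :=
  [set gamma | [/\ {within B_ Xs rho k, continuous gamma},
                   equivariant_on act act (B_ Xs rho k) gamma &
                   forall u, dB_ Xs rho k u -> gamma u = u]].

Definition c_ (R : realType) (X : normedModType R)
    (G : topologicalGroupType) (act : G -> X -> X) (Xs : nat -> set X)
    (rho : nat -> R) (I : X -> \bar R) (k : nat) : \bar R :=
  ereal_inf [set ereal_sup [set I (gamma u) | u in B_ Xs rho k]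
            | gamma in Theta_ act Xs rho k].

(* Main.v *)
(** Idea.  The levels [c_k] lie above [b_k], hence tend to infinity, because
    every admissible [gamma] sends some point of [B_k] into [Z_k] with norm
    [r_k].  To see this, compose [gamma] with an equivariant continuous map
    [Q : X -> Y_(k-1)] such that [x - Q x] lies in [Z_k]; admissibility on
    [V^k] produces a zero.  [Q] is the Haar average of a Lipschitz selection:
    the sum [Y_(k-1) + Z_k] is all of [X] but need not be direct.

    At a positive level [c = c_k], the Brezis-Browder ordering principle gives
    a [gamma] that cannot be improved for the order "[delta |eta - gamma|] is at
    most the decrease of the supremum of [I]".  If no point of [gamma(B_k)] of
    level at least [c - 2 delta] satisfied the Palais-Smale inequality with
    constant [4 delta], then local descent directions, glued by a partition of
    unity and averaged over [G], would improve [gamma].  Near the boundary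
    sphere the descent direction points to the radial projection of the
    argument, where [I <= 0 < c]; it vanishes on the sphere, so the boundary
    condition is kept.  Averaging preserves the descent because it is expressed
    by closed convex conditions that are uniform along [G]-orbits: an average
    belongs to every closed convex set containing the integrand. *)

Require Import Defs.
From HB Require Import structures.
From mathcomp Require Import all_boot all_order all_algebra.
From mathcomp Require Import all_classical all_reals all_analysis.
From mathcomp Require Import ring lra.

Set Implicit Arguments.
Unset Strict Implicit.
Unset Printing Implicit Defensive.

Import Order.TTheory GRing.Theory Num.Theory.
Import numFieldNormedType.Exports.

Local Open Scope classical_set_scope.
Local Open Scope ring_scope.

(** * Invariant mean of continuous functions on a compact group *)

(** Lower semicontinuity of [Psi] does not let the value of [I] along [gamma] be followed upwards,
    so descent is measured from the global level [M] of [gamma], with one step length [s] for the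
    whole of [K]. Sublevels of [I] need not be convex, since [Phi] is not, and neither gluing nor
    averaging would preserve them. Linearizing [Phi] at [gamma w] turns the decrease into a bound of
    [Psi] by an affine function, which is a convex condition.

    The constants follow. The linearized energy drops by [2 delta s]; the first-order error of [Phi]
    takes back at most [delta s]; the remaining [delta s] is what the order asks for a displacement
    of length at most [s]. The threshold [4 delta] is twice [2 delta] because a direction is given
    length one half at its base point, so that nearby its length stays at most one.

    On the topological side, the open set handed to admissibility must contain 0, which requires
    [gamma 0 = 0] although [gamma] takes its values in all of [X]. This holds because [X] has no
    nonzero fixed vector, a consequence of admissibility on [V^2] and of the density of the sum of
    the [X_j]. *)

Definition convex_subset (R : realType) (X : lmodType R) (C : set X) :=
  forall x y (a : R), C x -> C y -> 0 <= a <= 1 -> C (a *: x + (1 - a) *: y).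

(** Membership is asked only where the weight is positive: in a partition of unity a local map is
    controlled on the support of its own weight and nowhere else. *)
Lemma convex_sum (R : realType) (X : lmodType R) (C : set X) (I : Type)
    (s : seq I) (w : I -> R) (x : I -> X) :
  convex_subset C -> (forall i, 0 <= w i) -> (forall i, 0 < w i -> C (x i)) ->
  0 < \sum_(i <- s) w i ->
  C ((\sum_(i <- s) w i)^-1 *: \sum_(i <- s) w i *: x i).
Proof.
move=> cvC w0 Cx; elim: s => [|i s IH]; first by rewrite big_nil ltxx.
rewrite !big_cons.
have sw0 : 0 <= \sum_(j <- s) w j by apply: sumr_ge0.
have [wi0 _|] := ltP 0 (w i); last first.
  move=> wi0; have -> : w i = 0 by apply/le_anti; rewrite wi0 w0.
  by rewrite add0r scale0r add0r.
(* A tail of total weight 0 cannot be normalized for the induction hypothesis; in that case all its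
   terms vanish. *)
move: sw0; rewrite le_eqVlt => /predU1P[sw0|sw0]; last first.
  have wsgt0 : 0 < w i + \sum_(j <- s) w j by rewrite addr_gt0.
  have := cvC _ _ (w i / (w i + \sum_(j <- s) w j)) (Cx _ wi0) (IH sw0).
  rewrite scalerA scalerDr scalerA [_^-1 * w i]mulrC.
  have -> : (1 - w i / (w i + \sum_(j <- s) w j)) / (\sum_(j <- s) w j) =
    (w i + \sum_(j <- s) w j)^-1 by field; rewrite !gt_eqF.
  apply; rewrite divr_ge0 ?(ltW wi0) ?(ltW wsgt0) //=.
  by rewrite ler_pdivrMr // mul1r lerDl ltW.
have -> : \sum_(j <- s) w j *: x j = 0.
  elim: s sw0 {IH} => [|j s IH]; first by rewrite !big_nil.
  rewrite !big_cons => /esym/eqP; rewrite paddr_eq0 ?sumr_ge0 //.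
  by case/andP => /eqP -> /eqP /esym /IH ->; rewrite scale0r addr0.
rewrite -sw0 !addr0 scalerA mulVf ?scale1r ?gt_eqF //.
exact: Cx.
Qed.

Lemma compact_finite_nbhs (T : ptopologicalType) (K : set T) (N : T -> set T) :
  compact K -> (forall x, K x -> nbhs x (N x)) ->
  exists s : seq T, (forall x, x \in s -> K x) /\
    (forall x, K x -> exists2 y, y \in s & N y x).
Proof.
move=> cK nN.
have := cK; rewrite compact_cover => /(_ T K (fun x => (N x)°)).
case.
- by move=> i _; exact: open_interior.
- by move=> x Kx; exists x => //; apply: nN.
- move=> D DK cov; exists (finmap.enum_fset D); split => [x /DK|x /cov [y /= yD Ny]].
    by rewrite inE.
  by exists y => //; exact: interior_subset Ny.
Qed.

Section InvariantMean.
Variables (R : realType) (X : completeNormedModType R).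
Variables (G : topologicalGroupType) (mu : probability (borel G) R).

(** [t] encodes a finite Borel partition of [G] by sending each point to the label of its block, and
    [x] gives one value per block. The error is uniform in [g]. *)
Definition step_approx (f : G -> X) (e : R) n (t : G -> 'I_n) (x : 'I_n -> X) :=
  (forall i, measurable (t @^-1` [set i] : set (borel G))) /\
  forall g, `|f g - x (t g)| <= e.

Definition weight n (t : G -> 'I_n) (i : 'I_n) : R :=
  fine (mu (t @^-1` [set i])).

Definition step_sum n (t : G -> 'I_n) (x : 'I_n -> X) : X :=
  \sum_(i < n) weight t i *: x i.

Lemma weight_ge0 n (t : G -> 'I_n) i : 0 <= weight t i.
Proof. by rewrite fine_ge0. Qed.

Lemma weight_partition n (t : G -> 'I_n) (E : set (borel G)) :
  measurable E ->
  (forall i, measurable (t @^-1` [set i] : set (borel G))) ->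
  fine (mu E) = \sum_(i < n) fine (mu (E `&` t @^-1` [set i])).
Proof.
move=> mE mt.
have mF i : measurable (E `&` t @^-1` [set i] : set (borel G)).
  by apply: measurableI.
rewrite sum_fine; last by move=> i _; rewrite fin_num_measure.
rewrite -(@measure_bigsetU_ord _ _ _ mu n xpredT (fun i => E `&` t @^-1` [set i])) //.
  congr (fine (mu _)); apply/seteqP; split => [g Eg|g].
    by rewrite -bigcup_seq /=; exists (t g) => //=; rewrite mem_index_enum.
  by rewrite -bigcup_seq /= => -[i _ []].
by move=> i j _ _ [g [[_ <-] [_ <-]]].
Qed.

Lemma sum_weight n (t : G -> 'I_n) :
  (forall i, measurable (t @^-1` [set i] : set (borel G))) ->
  \sum_(i < n) weight t i = 1.
Proof.
move=> mt; transitivity (fine (mu setT)); last by rewrite probability_setT.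
rewrite (weight_partition _ mt) //.
by apply: eq_bigr => i _; rewrite setTI.
Qed.

(** Both sums are rewritten over the common refinement of the two partitions, whose weights [p i j]
    add up to 1. A nonempty block contains some [g], and the two values are compared through [f g]
    and [f' g]. *)
Lemma step_sum_dist (f f' : G -> X) d e e' n n' (t : G -> 'I_n) x
    (t' : G -> 'I_n') x' :
  (forall g, `|f g - f' g| <= d) ->
  step_approx f e t x -> step_approx f' e' t' x' ->
  `|step_sum t x - step_sum t' x'| <= d + e + e'.
Proof.
move=> dff [mt ft] [mt' ft'].
pose p i j := fine (mu (t @^-1` [set i] `&` t' @^-1` [set j])).
have p_ge0 i j : 0 <= p i j by rewrite fine_ge0.
have wp i : weight t i = \sum_(j < n') p i j by apply: weight_partition.
have wp' j : weight t' j = \sum_(i < n) p i j.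
  rewrite /weight (weight_partition (mt' j) mt); apply: eq_bigr => i _.
  by rewrite setIC.
have sp : \sum_(i < n) \sum_(j < n') p i j = 1.
  by rewrite -(sum_weight mt); apply: eq_bigr => i _; rewrite wp.
have -> : step_sum t x = \sum_(i < n) \sum_(j < n') p i j *: x i.
  by apply: eq_bigr => i _; rewrite wp scaler_suml.
have -> : step_sum t' x' = \sum_(i < n) \sum_(j < n') p i j *: x' j.
  rewrite exchange_big; apply: eq_bigr => j _.
  by rewrite wp' scaler_suml.
rewrite -sumrB -[leRHS]mul1r -sp mulr_suml.
apply: le_trans (ler_norm_sum _ _ _) _; apply: ler_sum => i _.
rewrite -sumrB mulr_suml.
apply: le_trans (ler_norm_sum _ _ _) _; apply: ler_sum => j _.
rewrite -scalerBr normrZ ger0_norm //.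
have [pij0|/set0P[g [/= <- <-]]] := eqVneq (t @^-1` [set i] `&` t' @^-1` [set j]) set0.
  by rewrite /p pij0 measure0 !mul0r.
apply: ler_wpM2l => //.
have -> : x (t g) - x' (t' g) = (f g - f' g) - (f g - x (t g)) + (f' g - x' (t' g)).
  by rewrite opprB [f g - f' g + _]addrC !subrKA.
apply: le_trans (ler_normD _ _) _; apply: lerD => //.
by apply: le_trans (ler_normB _ _) _; apply: lerD.
Qed.

Hypothesis cG : compact [set: G].

Lemma measurable_borel_open (U : set (borel G)) : @open G U -> measurable U.
Proof. by move=> oU; apply: sub_sigma_algebra. Qed.

(** Labelling a point by the first set of the list that contains it turns a finite cover into a
    partition, whose blocks are Boolean combinations of the sets [N y]. *)
Lemma measurable_find (N : G -> set (borel G)) (s : seq G) (i : nat) :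
  (forall y, measurable (N y)) ->
  measurable ([set g | find (fun y => `[< N y g >]) s = i] : set (borel G)).
Proof.
move=> mN; elim: s i => [|y s IH] i /=.
  case: i => [|i].
    by rewrite (_ : mkset _ = setT) //; apply/seteqP; split.
  by rewrite (_ : mkset _ = set0) //; apply/seteqP; split.
case: i => [|i].
  rewrite (_ : mkset _ = N y) //; apply/seteqP; split => g /=.
    by case: asboolP.
  by case: asboolP.
rewrite (_ : mkset _ = ~` N y `&`
   ([set g | find (fun y => `[< N y g >]) s = i] : set (borel G))).
  by apply: measurableI => //; apply: measurableC.
apply/seteqP; split => g /=.
  by case: asboolP => // Ny [].
by case: asboolP => [Ny []|_ [_ ->]].
Qed.

(** That the step values are values of [f] matters later: it keeps the step sum inside any convex
    set that contains the range of [f]. *)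
Lemma step_approx_exists (f : G -> X) (e : R) : continuous f -> 0 < e ->
  exists n (t : G -> 'I_n) x, step_approx f e t x /\
    forall i, exists g, x i = f g.
Proof.
move=> cf e0.
pose N (y : G) : set (borel G) := [set g : G | `|f y - f g| < e].
have oN y : @open G (N y).
  have -> : N y = f @^-1` (ball (f y) e).
    by rewrite -ball_normE.
  by apply: open_comp => [x _|]; [exact: cf|exact: ball_open].
have [s [_ sN]] : exists s : seq G, (forall x, x \in s -> setT x) /\
    (forall x, setT x -> exists2 y, y \in s & N y x).
  apply: compact_finite_nbhs cG _ => x _.
  apply: open_nbhs_nbhs; split; first exact: oN.
  by rewrite /N /= subrr normr0.
have hs g : (find (fun y => `[< N y g >]) s < size s)%N.
  rewrite -has_find; apply/hasP.
  by have [y ys Ny] := sN g I; exists y => //; apply/asboolP.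
exists (size s), (fun g => Ordinal (hs g)), (fun i => f (nth 1%g s i)).
split; last by move=> i; exists (nth 1%g s i).
split => [i|g].
  rewrite (_ : _ @^-1` _ = [set g | find (fun y => `[< N y g >]) s = i :> nat]).
    by apply: measurable_find => y; apply: measurable_borel_open; apply: oN.
  by apply/seteqP; split => g /=; [move=> <-|move=> h; exact: val_inj].
have : has (fun y => `[< N y g >]) s by rewrite has_find.
by move=> /(nth_find 1%g)/asboolP; rewrite /N /= distrC => /ltW.
Qed.

(** For a continuous function on a compact group uniform step approximations exist, so the integral
    can be characterized without almost everywhere convergence and without integrating norms. *)
Definition is_mean (f : G -> X) (v : X) := forall e, 0 < e ->
  exists n (t : G -> 'I_n) x, step_approx f e t x /\ `|v - step_sum t x| <= e.

Lemma is_mean_dist f f' d v v' : (forall g, `|f g - f' g| <= d) ->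
  is_mean f v -> is_mean f' v' -> `|v - v'| <= d.
Proof.
move=> dff fv fv'; apply/ler_addgt0Pr => e e0.
have e4 : 0 < e / 4 by rewrite divr_gt0.
have [n [t [x [ft vt]]]] := fv _ e4.
have [n' [t' [x' [ft' vt']]]] := fv' _ e4.
have h := step_sum_dist dff ft ft'.
have -> : v - v' = (v - step_sum t x) + (step_sum t x - step_sum t' x') -
    (v' - step_sum t' x').
  by rewrite opprB !subrKA.
apply: le_trans (ler_normB _ _) _.
apply: le_trans (lerD (ler_normD _ _) vt') _.
by apply: le_trans (lerD (lerD vt h) (lexx _)) _; lra.
Qed.

Lemma is_mean_unique f v v' : is_mean f v -> is_mean f v' -> v = v'.
Proof.
move=> fv fv'; apply/eqP; rewrite -subr_eq0 -normr_le0.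
by apply: is_mean_dist fv fv' => g; rewrite subrr normr0.
Qed.

(** Step sums with error [1/(k+1)] form a Cauchy sequence by [step_sum_dist] with [d = 0]. *)
Lemma is_mean_exists f : continuous f -> exists v, is_mean f v.
Proof.
move=> cf.
have q (k : nat) : exists p : {n & ((G -> 'I_n) * ('I_n -> X))%type},
    step_approx f k.+1%:R^-1 (projT2 p).1 (projT2 p).2.
  have [|n [t [x [h _]]]] := @step_approx_exists f k.+1%:R^-1 cf.
    by rewrite invr_gt0.
  by exists (existT _ n (t, x)).
have [p hp] := choice q.
pose S k := step_sum (projT2 (p k)).1 (projT2 (p k)).2.
have SS k l : `|S k - S l| <= k.+1%:R^-1 + l.+1%:R^-1.
  have := @step_sum_dist f f 0 _ _ _ _ _ _ _ _ _ (hp k) (hp l).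
  by rewrite add0r; apply => g; rewrite subrr normr0.
have inv0 : (k.+1%:R^-1 : R) @[k --> \oo] --> 0.
  exact: cvg_harmonic.
have small e : 0 < e -> \forall k \near \oo, (k.+1%:R^-1 : R) < e.
  move=> e0; have /cvgrPdist_lt /(_ e e0) := inv0.
  by apply: filterS => k; rewrite sub0r normrN ger0_norm // invr_ge0.
have cS : cvg (S @ \oo).
  apply/cauchy_cvgP/cauchy_exP => e e0.
  have e2 : 0 < e / 2 by rewrite divr_gt0.
  have [k /= ke] := filter_ex (small _ e2).
  exists (S k); apply: filterS (small _ e2) => l /= le.
  rewrite -ball_normE /=.
  by apply: le_lt_trans (SS _ _) _; rewrite [ltRHS]splitr; apply: ltrD.
exists (lim (S @ \oo)) => e e0.
have /cvgrPdist_le /(_ e e0) h := cS.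
near \oo => k.
exists (projT1 (p k)), (projT2 (p k)).1, (projT2 (p k)).2; split; last first.
  by near: k.
split; first by case: (hp k).
move=> g; have [_ /(_ g)/le_trans] := hp k; apply.
by apply/ltW; near: k; exact: small.
Unshelve. all: end_near. Qed.

Definition mean (f : G -> X) : X := xget 0 (is_mean f).

Lemma meanP f : continuous f -> is_mean f (mean f).
Proof. by move=> /is_mean_exists [v fv]; apply: xgetI fv. Qed.

Lemma mean_dist f f' d : continuous f -> continuous f' ->
  (forall g, `|f g - f' g| <= d) -> `|mean f - mean f'| <= d.
Proof.
by move=> cf cf' dff; apply: is_mean_dist dff (meanP cf) (meanP cf').
Qed.

Lemma mean_comp (L : X -> X) f : linear L -> (forall v, `|L v| = `|v|) ->
  continuous f -> mean (L \o f) = L (mean f).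
Proof.
move=> linL isoL cf.
have LB a b : L a - L b = L (a - b).
  rewrite -scaleN1r addrC -linL scaleN1r addrC //.
have L0 : L 0 = 0 by rewrite -[X in L X](subrr 0) -LB subrr.
have LZ a v : L (a *: v) = a *: L v by rewrite -[in LHS](addr0 (a *: v)) linL L0 addr0.
have LD a b : L (a + b) = L a + L b by rewrite -[in LHS](scale1r a) linL scale1r.
have cLf : continuous (L \o f).
  move=> g; apply/cvgrPdist_lt => e e0.
  have /cvgrPdist_lt /(_ e e0) := cf g.
  by apply: filterS => h; rewrite /= LB isoL.
apply: is_mean_unique (meanP cLf) _ => e e0.
have [n [t [x [[mt ft] h]]]] := meanP cf e0.
exists n, t, (L \o x); split; [split => //|].
  by move=> g /=; rewrite LB isoL.
suff -> : step_sum t (L \o x) = L (step_sum t x) by rewrite LB isoL.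
rewrite /step_sum (big_morph L LD L0); apply: eq_bigr => i _.
by rewrite LZ.
Qed.

(** Translating the labelling of a step approximation of [f] gives one of the translated function,
    and left invariance keeps the measure of each block. *)
Lemma mean_translate (h : G) f : is_haar mu -> continuous f ->
  mean (fun g => f (h * g)%g) = mean f.
Proof.
move=> [inv _] cf.
have ch : continuous (fun g : G => (h * g)%g).
  move=> g; apply: (@cvg_comp _ _ _ (fun g => (h, g))
    (fun p : G * G => (p.1 * p.2)%g) _ (nbhs (h, g))).
    by apply: cvg_pair; [exact: cvg_cst|exact: cvg_id].
  exact: (mulg_continuous (h, g)).
have mh (A : set (borel G)) : measurable A ->
    measurable ((fun g : G => (h * g)%g) @^-1` A : set (borel G)).
  move=> mA; rewrite -[X in measurable X]setTI.
  apply: (@measurability _ _ (borel G) (borel G) setT (fun g : G => (h * g)%g)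
    (@open G)) => //.
  move=> _ [U oU <-]; rewrite setTI.
  by apply: measurable_borel_open; apply: open_comp => // x _; exact: ch.
have cfh : continuous (fun g => f (h * g)%g).
  by move=> g; apply: continuous_comp; [exact: ch|exact: cf].
apply: is_mean_unique (meanP cfh) _ => e e0.
have [n [t [x [[mt ft] vt]]]] := meanP cf e0.
exists n, (fun g => t (h * g)%g), x; split; [split|].
- by move=> i; exact: (mh _ (mt i)).
- by move=> g; exact: ft.
suff -> : step_sum (fun g => t (h * g)%g) x = step_sum t x by [].
apply: eq_bigr => i _; congr (fine _ *: _).
rewrite -(inv h^-1%g _ (mt i)); congr (mu _).
apply/seteqP; split => [g /= <-|_ [g /= <- <-]].
  by exists (h * g)%g => //; rewrite mulKg.
by rewrite mulgA mulgV mul1g.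
Qed.

(** A step sum with values in the range of [f] is a convex combination of points of [C]. It is as
    close as desired to the step sums that define the mean, and [C] is closed. *)
Lemma mean_closed_convex f (C : set X) : continuous f -> closed C -> convex_subset C ->
  (forall g, C (f g)) -> C (mean f).
Proof.
move=> cf clC cvC Cf.
apply: clC => U /nbhs_ballP [e /= e0 eU].
have e2 : 0 < e / 2 by rewrite divr_gt0.
have e8 : 0 < e / 8 by rewrite divr_gt0.
have [n [t [x [ft xf]]]] := step_approx_exists cf e8.
have [n' [t' [x' [ft' vt']]]] := meanP cf e8.
exists (step_sum t x); split; last first.
  apply: eU; rewrite -ball_normE /=.
  have h : `|step_sum t' x' - step_sum t x| <= 0 + e / 8 + e / 8.
    by apply: step_sum_dist ft' ft => g; rewrite subrr normr0.
  have -> : mean f - step_sum t x = (mean f - step_sum t' x') + (step_sum t' x' - step_sum t x).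
    by rewrite subrKA.
  apply: le_lt_trans (ler_normD _ _) _.
  by apply: le_lt_trans (lerD vt' h) _; lra.
have Cx i : C (x i) by have [g ->] := xf i.
have := @convex_sum _ _ C _ (index_enum 'I_n) (weight t) x cvC (@weight_ge0 n t)
  (fun i _ => Cx i).
by rewrite sum_weight ?invr1 ?scale1r; [apply|exact: ft.1].
Qed.

End InvariantMean.

(** * Finite-dimensional subspaces of a normed space *)

Section FiniteDimension.
Variables (R : realType) (X : normedModType R).

Lemma linear_fun0 (U : lmodType R) (L : U -> X) : linear L -> L 0 = 0.
Proof. by move=> h; have := h (-1) 0 0; rewrite scaler0 add0r scaleN1r addNr. Qed.

Lemma linear_funZ (U : lmodType R) (L : U -> X) a x : linear L -> L (a *: x) = a *: L x.
Proof. by move=> h; have := h a x 0; rewrite linear_fun0 // !addr0. Qed.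

Lemma linear_funD (U : lmodType R) (L : U -> X) x y : linear L -> L (x + y) = L x + L y.
Proof. by move=> h; have := h 1 x y; rewrite !scale1r. Qed.

Lemma linear_funN (U : lmodType R) (L : U -> X) x : linear L -> L (- x) = - L x.
Proof. by move=> h; rewrite -scaleN1r linear_funZ // scaleN1r. Qed.

Lemma linear_funB (U : lmodType R) (L : U -> X) x y : linear L -> L (x - y) = L x - L y.
Proof. by move=> h; rewrite linear_funD // linear_funN. Qed.

Lemma subspaceZ (A : set X) a x : is_subspace A -> A x -> A (a *: x).
Proof. by move=> [A0 h] Ax; have := h a x 0 Ax A0; rewrite addr0. Qed.

Lemma subspaceD (A : set X) x y : is_subspace A -> A x -> A y -> A (x + y).
Proof. by move=> [A0 h] Ax Ay; have := h 1 x y Ax Ay; rewrite scale1r. Qed.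

Lemma subspaceB (A : set X) x y : is_subspace A -> A x -> A y -> A (x - y).
Proof.
by move=> sA Ax Ay; apply: subspaceD => //; rewrite -scaleN1r; apply: subspaceZ.
Qed.

Lemma subspaceN (A : set X) x : is_subspace A -> A x -> A (- x).
Proof. by move=> sA Ax; rewrite -scaleN1r; apply: subspaceZ. Qed.

Lemma subspace_sum (A : set X) (I : Type) (s : seq I) (P : pred I) (F : I -> X) :
  is_subspace A -> (forall i, P i -> A (F i)) -> A (\sum_(i <- s | P i) F i).
Proof.
move=> sA AF; elim/big_rec: _ => [|i x Pi Ax]; first exact: sA.1.
by apply: subspaceD => //; apply: AF.
Qed.

Lemma subspace_convex (A : set X) : is_subspace A -> convex_subset A.
Proof.
by move=> sA x y a Ax Ay _; apply: subspaceD => //; exact: subspaceZ.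
Qed.

Lemma closure_subspace (A : set X) : is_subspace A -> is_subspace (closure A).
Proof.
move=> sA; split; first exact/subset_closure/sA.1.
move=> a x y cAx cAy U.
have cont : (fun p : X * X => a *: p.1 + p.2) @ (x, y) --> a *: x + y.
  apply: cvgD; last exact: cvg_snd.
  by apply: cvgZr; exact: cvg_fst.
move=> /cont [[V W] /= [Vx Wy] VW].
have [x' [Ax' Vx']] := cAx _ Vx; have [y' [Ay' Wy']] := cAy _ Wy.
exists (a *: x' + y'); split; first exact: sA.2.
exact: (VW (x', y')).
Qed.

(* By minimality, [range L] is a complement of [Y `&` Z] in [Y]. *)
Lemma minimal_parametrization n (L0 : 'rV[R]_n -> X) (Y Z : set X) :
  is_subspace Z -> linear L0 -> (forall a, Y (L0 a)) ->
  (forall y, Y y -> exists a, Z (y - L0 a)) ->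
  exists m (L : 'rV[R]_m -> X), [/\ linear L, forall a, Y (L a),
    forall y, Y y -> exists a, Z (y - L a) & forall a, Z (L a) -> a = 0].
Proof.
move=> sZ linL0 YL0 L0Y.
pose P m := `[< exists L : 'rV[R]_m -> X, [/\ linear L, forall a, Y (L a) &
    forall y, Y y -> exists a, Z (y - L a)] >].
have exP : exists m, P m by exists n; apply/asboolP; exists L0.
case: (ex_minnP exP) => m /asboolP [L [linL YL LY]] minm.
exists m, L; split => // a Za; apply: contrapT => a0.
have [i ai] : exists i, a ord0 i != 0.
  apply: contrapT => h; apply: a0; apply/rowP => i; rewrite mxE.
  by apply/eqP/negPn/negP => ai; apply: h; exists i.
case: m => [|m] in L linL YL LY minm a Za a0 i ai *; first by case: i ai.
suff : P m by move=> /minm; rewrite ltnn.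
(* Since [L a] lies in [Z] and [a] has a nonzero coordinate [i], a multiple of [a] can be subtracted
   modulo [Z] to cancel coordinate [i]. The hyperplane where it vanishes, embedded by [ins], thus
   still represents [Y] modulo [Z] with one parameter fewer. *)
pose ins (b : 'rV[R]_m) : 'rV[R]_m.+1 :=
  \row_j (if unlift i j is Some j' then b ord0 j' else 0).
apply/asboolP; exists (L \o ins); split.
- move=> c x y /=; rewrite -linL; congr L; apply/rowP => j; rewrite !mxE.
  by case: unliftP => [j' _|_]; rewrite ?mxE // mulr0 addr0.
- by move=> b; exact: YL.
- move=> y Yy; have [c Zc] := LY y Yy.
  pose c' := c - (c ord0 i / a ord0 i) *: a.
  exists (\row_j c' ord0 (lift i j)) => /=.
  have -> : ins (\row_j c' ord0 (lift i j)) = c'.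
    apply/rowP => j; rewrite mxE; case: unliftP => [j' ->|->]; first by rewrite mxE.
    by rewrite !mxE divfK // subrr.
  rewrite /c' linear_funB // linear_funZ // opprB addrC addrAC -addrA.
  by apply: subspaceD => //; exact: subspaceZ.
Qed.

Lemma linear_rV_bounded n (L : 'rV[R]_n -> X) : linear L ->
  exists2 M, 0 < M & forall a, `|L a| <= M * `|a|.
Proof.
move=> linL.
have M0 : 0 <= \sum_(i < n) `|L (delta_mx ord0 i)| by apply: sumr_ge0.
exists (1 + \sum_(i < n) `|L (delta_mx ord0 i)|); first by rewrite ltr_wpDr.
move=> a; apply: (@le_trans _ _ ((\sum_(i < n) `|L (delta_mx ord0 i)|) * `|a|)); last first.
  by rewrite ler_wpM2r // lerDr.
rewrite [in leLHS](row_sum_delta a)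
  (big_morph L (fun x y => linear_funD x y linL) (linear_fun0 linL)).
apply: le_trans (ler_norm_sum _ _ _) _; rewrite mulr_suml; apply: ler_sum => i _.
rewrite linear_funZ // normrZ mulrC ler_wpM2l //.
rewrite [leRHS]/Num.norm /= mx_normrE.
by apply: (le_bigmax _ (fun ij : 'I_1 * 'I_n => `|a ij.1 ij.2|) (ord0, i)).
Qed.

Lemma linear_rV_continuous n (L : 'rV[R]_n -> X) : linear L -> continuous L.
Proof.
move=> linL a; have [M M0 LM] := linear_rV_bounded linL.
move=> U /nbhs_ballP [e /= e0 eU]; apply/nbhs_ballP.
exists (e / M) => /=; first by rewrite divr_gt0.
move=> b; rewrite -ball_normE /= => ab; apply: eU; rewrite -ball_normE /=.
rewrite -linear_funB //; apply: le_lt_trans (LM _) _.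
by rewrite mulrC -ltr_pdivlMr.
Qed.

(** On the unit sphere the distance from [L a] to the closed set [Z] is positive, and locally
    bounded below by continuity of [L]. Compactness gives a common bound [e], and homogeneity
    extends it to all [a]. *)
Lemma transverse_bound n (L : 'rV[R]_n -> X) (Z : set X) :
  linear L -> is_subspace Z -> closed Z -> (forall a, Z (L a) -> a = 0) ->
  exists2 c, 0 < c & forall a z, Z z -> c * `|a| <= `|L a - z|.
Proof.
move=> linL sZ cZ ZL.
pose S := [set a : 'rV[R]_n | `|a| = 1].
have cS : compact S.
  apply: bounded_closed_compact.
    by exists 1; split => // x x1 a /= ->; exact: ltW.
  have -> : S = (fun a => `|a|) @^-1` [set 1] by [].
  by apply: closed_comp => [a _|]; [exact: norm_continuous|exact: closed_eq].
have nS : forall a, S a -> \forall b \near a & e \near 0^'+,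
    forall z, Z z -> e <= `|L b - z|.
  move=> a Sa.
  have nZ : ~ Z (L a).
    by move=> /ZL a0; move: Sa; rewrite /S /= a0 normr0 => /esym/eqP; rewrite oner_eq0.
  have /nbhs_ballP [d /= d0 dZ] : nbhs (L a) (~` Z).
    by apply: open_nbhs_nbhs; split => //; exact: closed_openC.
  have d2 : 0 < d / 2 by rewrite divr_gt0.
  near=> b e => z Zz.
  have eLb : `|L a - L b| < d / 2.
    near: b; have /cvgrPdist_lt := linear_rV_continuous linL (x := a).
    by apply.
  have ed : e <= d / 2 by near: e; exact: nbhs_right_le.
  rewrite leNgt; apply/negP => zb.
  apply: (dZ z) => //; rewrite -ball_normE /=.
  rewrite -(subrKA (L b)); apply: le_lt_trans (ler_normD _ _) _.
  by rewrite [ltRHS]splitr; apply: ltrD => //; exact: lt_le_trans ed.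
have /compact_near_coveringP/(_ R 0^'+ (fun e b => forall z, Z z -> e <= `|L b - z|)) := cS.
move=> /(_ _ nS) h.
have [e [/= e0 eS]] : exists e, 0 < e /\ S `<=` (fun b => forall z, Z z -> e <= `|L b - z|).
  near (0:R)^'+ => e; exists e; split; first by [].
  by near: e.
exists e => // a z Zz.
have [->|a0] := eqVneq a 0; first by rewrite normr0 mulr0.
have na : 0 < `|a| by rewrite normr_gt0.
have := eS (`|a|^-1 *: a) _ (`|a|^-1 *: z) (subspaceZ _ sZ Zz).
rewrite /S /= normrZ normrV ?unitfE ?gt_eqF // normr_id mulVf ?gt_eqF // => /(_ erefl).
rewrite linear_funZ // -scalerBr normrZ normrV ?unitfE ?gt_eqF // normr_id.
by rewrite mulrC ler_pdivlMr.
Unshelve. all: end_near. Qed.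

(** The transverse bound confines the parameters of points near [x] to a compact ball. If no
    parameter worked for [x] itself, the distance from [x - L a] to [Z] would be bounded below on
    that ball, against [x] being a limit. *)
Lemma transverse_sum_closed n (L : 'rV[R]_n -> X) (Z : set X) :
  linear L -> is_subspace Z -> closed Z -> (forall a, Z (L a) -> a = 0) ->
  closed [set x | exists a, Z (x - L a)].
Proof.
move=> linL sZ cZ ZL x cx.
have [c c0 Lc] := transverse_bound linL sZ cZ ZL.
(* If [y] is within 1 of [x] and [y - L a] lies in [Z], then [c |a| <= |y| <= |x| + 1]. *)
pose T := (`|x| + 1) / c.
pose S := [set a : 'rV[R]_n | `|a| <= T].
have cS : compact S.
  apply: bounded_closed_compact.
    by exists T; split; [exact: num_real|move=> y Ty a /= /le_trans; apply; exact: ltW].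
  have -> : S = (fun a => `|a|) @^-1` [set y | y <= T] by [].
  by apply: closed_comp => [a _|]; [exact: norm_continuous|exact: closed_le].
apply: contrapT => nex.
have nS : forall a, S a -> \forall b \near a & e \near 0^'+,
    forall z, Z z -> e <= `|x - L b - z|.
  move=> a Sa.
  have nZ : ~ Z (x - L a) by move=> h; apply: nex; exists a.
  have /nbhs_ballP [d /= d0 dZ] : nbhs (x - L a) (~` Z).
    by apply: open_nbhs_nbhs; split => //; exact: closed_openC.
  have d2 : 0 < d / 2 by rewrite divr_gt0.
  near=> b e => z Zz.
  have eLb : `|L a - L b| < d / 2.
    near: b; have /cvgrPdist_lt := linear_rV_continuous linL (x := a).
    by apply.
  have ed : e <= d / 2 by near: e; exact: nbhs_right_le.
  rewrite leNgt; apply/negP => zb.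
  apply: (dZ z) => //; rewrite -ball_normE /=.
  rewrite -(subrKA (x - L b)); apply: le_lt_trans (ler_normD _ _) _.
  rewrite [ltRHS]splitr; apply: ltrD => //; last exact: lt_le_trans ed.
  by rewrite opprB addrC subrKA distrC.
have /compact_near_coveringP/(_ R 0^'+ (fun e b => forall z, Z z -> e <= `|x - L b - z|)) := cS.
move=> /(_ _ nS) h.
have [e [/= e0 eS]] : exists e, 0 < e /\ S `<=` (fun b => forall z, Z z -> e <= `|x - L b - z|).
  near (0:R)^'+ => e; exists e; split; first by [].
  by near: e.
have e1 : 0 < Num.min e 1 by rewrite lt_min e0 ltr01.
have [y [[a Zya] /=]] := cx _ (nbhsx_ballx x _ e1).
rewrite -ball_normE /= lt_min => /andP[xye xy1].
have Sa : S a.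
  rewrite /S /= /T ler_pdivlMr // mulrC.
  apply: le_trans (Lc a (L a - y) _) _; first by rewrite -opprB; exact: subspaceN.
  rewrite opprB addrC subrK.
  have -> : y = x - (x - y) by rewrite subKr.
  apply: le_trans (ler_normB _ _) _; rewrite lerD2l; exact: ltW.
have := eS a Sa (y - L a) Zya.
rewrite opprB addrA subrK leNgt => /negP; apply.
by rewrite (le_lt_trans _ xye).
Unshelve. all: end_near. Qed.

Lemma closed_singleton (x : X) : closed [set x].
Proof.
by apply: accessible_closed_set1; apply: hausdorff_accessible; exact: norm_hausdorff.
Qed.

Lemma range_closed n (L : 'rV[R]_n -> X) : linear L -> (forall a, L a = 0 -> a = 0) ->
  closed (range L).
Proof.
move=> linL Linj.
have -> : range L = [set x | exists a, [set 0 : X] (x - L a)].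
  apply/seteqP; split => [_ [a _ <-]|x [a /= /eqP]]; first by exists a; rewrite /= subrr.
  by rewrite subr_eq0 => /eqP ->; exists a.
apply: transverse_sum_closed => //.
  by split => // a x y -> ->; rewrite /= scaler0 addr0.
exact: closed_singleton.
Qed.

Lemma range_bounded_below n (L : 'rV[R]_n -> X) : linear L -> (forall a, L a = 0 -> a = 0) ->
  exists2 c, 0 < c & forall a, c * `|a| <= `|L a|.
Proof.
move=> linL Linj.
have [||c c0 h] := @transverse_bound _ L [set 0] linL _ _ Linj.
- by split => // a x y -> ->; rewrite /= scaler0 addr0.
- exact: closed_singleton.
by exists c => // a; have := h a 0 erefl; rewrite subr0.
Qed.

Lemma range_ball_compact n (L : 'rV[R]_n -> X) (r : R) : linear L ->
  (forall a, L a = 0 -> a = 0) -> compact [set x | range L x /\ `|x| <= r].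
Proof.
move=> linL Linj; have [c c0 cL] := range_bounded_below linL Linj.
have -> : [set x | range L x /\ `|x| <= r] = L @` [set a | `|L a| <= r].
  apply/seteqP; split => [_ [[a _ <-] ra]|_ [a ra <-]]; first by exists a.
  by split => //; exists a.
apply: continuous_compact; first exact/continuous_subspaceT/linear_rV_continuous.
apply: bounded_closed_compact.
  exists (r / c); split; first exact: num_real.
  move=> y ry a /= Lar; apply: le_trans (ltW ry).
  by rewrite ler_pdivlMr // mulrC; exact: le_trans (cL a) Lar.
have -> : [set a | `|L a| <= r] = (fun a => `|L a|) @^-1` [set y | y <= r] by [].
apply: closed_comp => [a _|]; last exact: closed_le.
apply: continuous_comp; first exact: linear_rV_continuous.
exact: norm_continuous.
Qed.

Lemma ball_convex (c : X) (r : R) : convex_subset [set x | `|c - x| <= r].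
Proof.
move=> x y a /= xr yr /andP[a0 a1].
have -> : c - (a *: x + (1 - a) *: y) = a *: (c - x) + (1 - a) *: (c - y).
  by rewrite !scalerBr !scalerBl !scale1r; rewrite addrACA subrKC opprD.
apply: le_trans (ler_normD _ _) _; rewrite !normrZ ger0_norm // ger0_norm ?subr_ge0 //.
have -> : r = a * r + (1 - a) * r by ring.
by apply: lerD; rewrite ler_wpM2l // subr_ge0.
Qed.

Lemma ball_closed (c : X) (r : R) : closed [set x | `|c - x| <= r].
Proof.
have -> : [set x | `|c - x| <= r] = (fun x => `|c - x|) @^-1` [set y | y <= r] by [].
apply: closed_comp => [x _|]; last exact: closed_le.
by apply: cvg_norm; apply: cvgB; [exact: cvg_cst|exact: cvg_id].
Qed.

End FiniteDimension.

(** * Averaging over an isometric action *)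

Lemma within_continuousP (R : realType) (X Y : normedModType R) (A : set X)
    (f : X -> Y) :
  {within A, continuous f} <-> forall x, A x -> forall e, 0 < e ->
    exists2 d, 0 < d & forall y, A y -> `|x - y| < d -> `|f x - f y| < e.
Proof.
rewrite subspace_continuousP; split => [cf x Ax e e0|h x Ax].
  have /nbhs_ballP [d /= d0 dA] : within A (nbhs x) [set y | `|f x - f y| < e].
    have := cf x Ax _ (nbhsx_ballx (f x) e e0).
    by rewrite /= -ball_normE.
  exists d => // y Ay xy; apply: dA => //.
  by rewrite -ball_normE.
move=> U /nbhs_ballP [e /= e0 eU]; have [d d0 hd] := h x Ax e e0.
apply/nbhs_ballP; exists d => //= y; rewrite -ball_normE /= => xy Ay.
by apply: eU; rewrite -ball_normE /=; exact: hd.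
Qed.

Lemma cvg_within_comp (T U V : topologicalType) (A : set U) (h : T -> U)
    (f : U -> V) (t : T) :
  {within A, continuous f} -> {for t, continuous h} -> A (h t) ->
  (\forall s \near t, A (h s)) -> {for t, continuous (f \o h)}.
Proof.
rewrite subspace_continuousP => cf ch Aht nA W /(cf _ Aht) /=.
rewrite /within /= => /ch /=; rewrite !nbhs_simpl /= => H.
have : nbhs t [set s | A (h s) /\ (A (h s) -> W (f (h s)))].
  by apply: filterI => //; exact: H.
by apply: filterS => s [Ah]; apply.
Qed.

Section Averaging.
Variables (R : realType) (X : completeNormedModType R).
Variables (G : topologicalGroupType) (mu : probability (borel G) R).
Variable (act : G -> X -> X).
Hypotheses (cG : compact [set: G]) (hmu : is_haar mu).
Hypotheses (actP : is_action act) (isoP : isometric_action act).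

Lemma act_linear g : linear (act g).
Proof. by case: actP => _ _ _ h a v w; exact: h. Qed.

Lemma act1 v : act 1%g v = v. Proof. by case: actP. Qed.

Lemma actM g h v : act (g * h)%g v = act g (act h v). Proof. by case: actP. Qed.

Lemma actK g v : act g^-1%g (act g v) = v.
Proof. by rewrite -actM mulVg act1. Qed.

Lemma actVK g v : act g (act g^-1%g v) = v.
Proof. by rewrite -actM mulgV act1. Qed.

Lemma act_dist g v w : `|act g v - act g w| = `|v - w|.
Proof. by rewrite -(linear_funB _ _ (act_linear g)) isoP. Qed.

Lemma act_continuous g : continuous (act g).
Proof.
move=> v U /nbhs_ballP [e /= e0 eU]; apply/nbhs_ballP.
exists e => //= w; rewrite -ball_normE /= => vw; apply: eU.
by rewrite -ball_normE /= act_dist.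
Qed.

Lemma act_fun_continuous (f : G -> X) :
  continuous f -> continuous (fun g => act g (f g)).
Proof.
move=> cf g.
apply: (@cvg_comp _ _ _ (fun g => (g, f g)) (fun p : G * X => act p.1 p.2) _ (nbhs (g, f g))).
  by apply: cvg_pair; [exact: cvg_id|exact: cf].
by case: actP => cact _ _ _; exact: (cact (g, f g)).
Qed.

Lemma orbit_map_continuous (v : X) : continuous (fun g => act g v).
Proof. by apply: act_fun_continuous => g; exact: cvg_cst. Qed.

Lemma orbit_mapV_continuous (v : X) : continuous (fun g => act g^-1%g v).
Proof.
move=> g; apply: (@continuous_comp _ _ _ (fun g : G => g^-1%g) (fun g => act g v)).
  exact: invg_continuous.
exact: orbit_map_continuous.
Qed.

(** The symmetrization of [F]: the Haar mean of its conjugates under the action. *)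
Definition average (F : X -> X) (w : X) : X :=
  mean mu (fun g => act g (F (act g^-1%g w))).

Section InvariantDomain.
Variables (W : set X) (F : X -> X).
Hypothesis (invW : forall g w, W w -> W (act g w)).
Hypothesis (cF : {within W, continuous F}).

Lemma average_integrand_continuous w : W w ->
  continuous (fun g => act g (F (act g^-1%g w))).
Proof.
move=> Ww; apply: act_fun_continuous => g.
apply: (@cvg_within_comp _ _ _ W (fun g => act g^-1%g w) F) => //.
- exact: orbit_mapV_continuous.
- exact: invW.
- by near=> h; exact: invW.
Unshelve. all: end_near. Qed.

(** [act h] enters the mean as a linear isometry; the integrand at [act h w] then becomes the former
    one after the substitution of [h * g] for [g]. *)
Lemma average_equivariant : equivariant_on act act W (average F).
Proof.
move=> h w Ww; rewrite /average -(mean_comp mu cG (act_linear h) (isoP h)); last first.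
  exact: average_integrand_continuous.
rewrite -(mean_translate cG h hmu); last exact/average_integrand_continuous/invW.
congr (mean mu _); apply/funext => g /=.
by rewrite actM invgM actM actK.
Qed.

Lemma average_closed_convex w (C : set X) : W w -> closed C ->
  convex_subset C -> (forall g, C (act g (F (act g^-1%g w)))) -> C (average F w).
Proof.
move=> Ww clC cvC CF; apply: mean_closed_convex => //.
exact: average_integrand_continuous.
Qed.

(** Uniform continuity is the right hypothesis because [w] and [w'] are compared at all points of
    their orbits at once; the isometries preserve the distance between them. *)
Lemma average_continuous :
  (forall e, 0 < e -> exists2 d, 0 < d &
     forall w w', W w -> W w' -> `|w - w'| < d -> `|F w - F w'| < e) ->
  {within W, continuous (average F)}.
Proof.
move=> ucF; apply/within_continuousP => w Ww e e0.
have e2 : 0 < e / 2 by rewrite divr_gt0.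
have [d d0 dF] := ucF _ e2; exists d => // w' Ww' ww'.
apply: (@le_lt_trans _ _ (e / 2)); last by rewrite ltr_pdivrMr // mulr_natr mulr2n ltrDl.
apply: mean_dist => //; try exact: average_integrand_continuous.
move=> g; rewrite act_dist; apply/ltW/dF; [exact: invW|exact: invW|].
by rewrite act_dist.
Qed.

End InvariantDomain.

(** At the fixed point 0 the average of the constant map [u] is the barycenter of the orbit of [u];
    equivariance at 0 says that it is fixed. *)
Lemma average_fixed (u : X) : (forall h, act h (average (fun=> u) 0) = average (fun=> u) 0).
Proof.
move=> h; rewrite -(@average_equivariant [set 0] (fun=> u)) //.
- by move=> g w ->; rewrite /= (linear_fun0 (act_linear g)).
- by apply: continuous_subspaceT => x; exact: cvg_cst.
Qed.

End Averaging.

(** The Heine-Cantor theorem, for continuity relative to [K]. *)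
Lemma compact_uniform (R : realType) (X Y : normedModType R) (K : set X) (F : X -> Y) :
  compact K -> {within K, continuous F} ->
  forall e, 0 < e -> exists2 d, 0 < d &
    forall w w', K w -> K w' -> `|w - w'| < d -> `|F w - F w'| < e.
Proof.
move=> cK /within_continuousP cF e e0.
have e2 : 0 < e / 2 by rewrite divr_gt0.
have H : \forall d \near 0^'+, K `<=` (fun w => forall w', K w -> K w' ->
    `|w - w'| < d -> `|F w - F w'| < e).
  apply: (compact_near_coveringP K).1 => // w Kw.
  have [d d0 dF] := cF w Kw _ e2.
  have d2 : 0 < d / 2 by rewrite divr_gt0.
  near=> v t => v' Kv Kv' vv'.
  have wv : `|w - v| < d / 2.
    by near: v; have := nbhsx_ballx w _ d2; rewrite -ball_normE.
  have td : t <= d / 2 by near: t; exact: nbhs_right_le.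
  rewrite -(subrKA (F w)) [e]splitr; apply: le_lt_trans (ler_normD _ _) _.
  apply: ltrD; first by rewrite distrC; apply: dF => //; apply: lt_trans wv _; lra.
  apply: dF => //; rewrite -(subrKA v); apply: le_lt_trans (ler_normD _ _) _.
  rewrite [d]splitr; apply: ltrD => //; exact: lt_le_trans vv' td.
have [d [d0 dK]] := filter_ex (filterI (nbhs_right_gt (0 : R)) H).
by exists d => // w w' Kw Kw'; exact: (dK w Kw).
Unshelve. all: end_near. Qed.

(** * The spaces Y_k and Z_k *)

Section FiniteDimensionalSpace.
Variables (R : realType) (V : normedModType R).
Hypothesis fdV : finite_dimensional V.

Lemma subspace0 : is_subspace [set 0 : V].
Proof. by split => // a x y -> ->; rewrite /= scaler0 addr0. Qed.

(** Minimal parametrization with [Z = {0}] extracts a basis from a spanning family. *)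
Lemma finite_dimensional_basis : exists n (E : 'rV[R]_n -> V),
  [/\ linear E, forall a, E a = 0 -> a = 0 & forall v, exists a, v = E a].
Proof.
have [n [e espan]] := fdV.
have [||||m [L [linL _ sL iL]]] := @minimal_parametrization R V n
    (fun a => \sum_(i < n) a ord0 i *: e i) setT [set 0].
- exact: subspace0.
- move=> c x y; rewrite scaler_sumr -big_split; apply: eq_bigr => i _ /=.
  by rewrite !mxE scalerDl scalerA.
- by [].
- move=> v _; have [a ->] := espan v; exists (\row_i a i) => /=.
  by apply/eqP; rewrite subr_eq0; apply/eqP/eq_bigr => i _; rewrite mxE.
exists m, L; split => // v; have [a /= /eqP] := sL v I.
by rewrite subr_eq0 => /eqP va; exists a.
Qed.

Lemma finite_dimensional_bounded (X : normedModType R) (f : V -> X) :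
  linear f -> exists2 M, 0 < M & forall v, `|f v| <= M * `|v|.
Proof.
move=> linf; have [n [E [linE injE surE]]] := finite_dimensional_basis.
have linfE : linear (f \o E) by move=> c x y /=; rewrite linE linf.
have [M M0 fM] := linear_rV_bounded linfE.
have [c c0 Ec] := range_bounded_below linE injE.
exists (M / c) => [|v]; first by rewrite divr_gt0.
have [a ->] := surE v; apply: le_trans (fM a) _; rewrite -mulrA ler_pM2l //.
by rewrite ler_pdivlMl.
Qed.

Lemma finite_dimensional_continuous (X : normedModType R) (f : V -> X) :
  linear f -> continuous f.
Proof.
move=> linf v U /nbhs_ballP [e /= e0 eU]; apply/nbhs_ballP.
have [M M0 fM] := finite_dimensional_bounded linf.
exists (e / M) => /=; first by rewrite divr_gt0.
move=> w; rewrite -ball_normE /= => vw; apply: eU; rewrite -ball_normE /=.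
rewrite -linear_funB //; apply: le_lt_trans (fM _) _.
by rewrite mulrC -ltr_pdivlMr.
Qed.

End FiniteDimensionalSpace.

Section AlgebraicSums.
Variables (R : realType) (X : normedModType R) (Xs : nat -> set X).

(** Padding with zeros makes the length of the sum arbitrary beyond [n], so that two elements can be
    written with the same length and added. *)
Lemma sum_of_stable (P : pred nat) u : sum_of Xs P u -> (forall j, P j -> is_subspace (Xs j)) ->
  exists n x, (forall j, P j -> Xs j (x j)) /\
    forall N, (n <= N)%N -> u = \sum_(0 <= j < N | P j) x j.
Proof.
move=> [n [x [Xx ->]]] sXs; exists n, (fun j => if (j < n)%N then x j else 0); split.
  by move=> j Pj; case: ifP => _; [exact: Xx|exact: (sXs j Pj).1].
move=> N nN; rewrite (big_nat_widen _ _ _ _ _ nN) [RHS]big_mkcond [LHS]big_mkcond.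
by apply: eq_bigr => j _; case: (P j).
Qed.

Lemma sum_of_subspace (P : pred nat) : (forall j, P j -> is_subspace (Xs j)) ->
  is_subspace (sum_of Xs P).
Proof.
move=> sXs; split.
  exists 0%N, (fun=> 0); split; last by rewrite big_geq.
  by move=> j Pj; exact: (sXs j Pj).1.
move=> a u v /sum_of_stable /(_ sXs) [n [x [Xx ux]]] /sum_of_stable /(_ sXs) [m [y [Xy vy]]].
exists (n + m)%N, (fun j => a *: x j + y j); split.
  by move=> j Pj; apply: (sXs j Pj).2; [exact: Xx|exact: Xy].
rewrite (ux (n + m)%N (leq_addr _ _)) (vy (n + m)%N (leq_addl _ _)).
by rewrite scaler_sumr -big_split.
Qed.

Lemma sub_sum_of (P : pred nat) j : (forall j, P j -> is_subspace (Xs j)) ->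
  P j -> Xs j `<=` sum_of Xs P.
Proof.
move=> sXs Pj u Xu; exists j.+1, (fun i => if i == j then u else 0); split.
  by move=> i Pi; case: eqP => [->//|_]; exact: (sXs i Pi).1.
rewrite big_mkcond big_nat_recr //= Pj eqxx big1_seq ?add0r // => i /andP[_].
rewrite mem_index_iota => /andP[_ /ltn_eqF ->].
by case: (P i).
Qed.

Lemma sum_of_min (P : pred nat) (W : set X) : is_subspace W ->
  (forall j, P j -> Xs j `<=` W) -> sum_of Xs P `<=` W.
Proof.
move=> sW XW _ [n [x [Xx ->]]]; apply: subspace_sum => // j Pj.
exact: (XW j Pj _ (Xx j Pj)).
Qed.

End AlgebraicSums.

Section Geometry.
Variables (R : realType) (X : completeNormedModType R).
Variables (G : topologicalGroupType) (mu : probability (borel G) R).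
Variables (act : G -> X -> X) (Xs : nat -> set X).
Hypotheses (hG0 : condition_G0 act Xs) (hmu : is_haar mu).

Let cG : compact [set: G]. Proof. by case: hG0. Qed.
Let actP : is_action act. Proof. by case: hG0. Qed.
Let isoP : isometric_action act. Proof. by case: hG0. Qed.
Let sXs j : (1 <= j)%N -> is_subspace (Xs j).
Proof. by case: hG0 => _ _ _ _ [h _] /h []. Qed.

Lemma Xs_act j g u : (1 <= j)%N -> Xs j u -> Xs j (act g u).
Proof.
by case: hG0 => _ _ _ _ [h _] /h [_ /(_ g) e] Xu; rewrite -e; exists u.
Qed.

Lemma sum_of_act (P : pred nat) g u : (forall j, P j -> (1 <= j)%N) ->
  sum_of Xs P u -> sum_of Xs P (act g u).
Proof.
move=> P1; have sP : forall j, P j -> is_subspace (Xs j).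
  by move=> j /P1; exact: sXs.
have sS := sum_of_subspace sP.
apply: (@sum_of_min _ _ _ _ (act g @^-1` sum_of Xs P)) => /=.
  split; first by rewrite /= (linear_fun0 (act_linear actP g)); exact: sS.1.
  by move=> a x y /= Sx Sy; rewrite (act_linear actP g); exact: sS.2.
by move=> j Pj v Xv; apply: (sub_sum_of sP Pj); apply: Xs_act => //; exact: P1.
Qed.

Lemma Y_subspace k : is_subspace (Y_ Xs k).
Proof. by apply: sum_of_subspace => j /andP[j1 _]; exact: sXs. Qed.

Lemma Y_act k g u : Y_ Xs k u -> Y_ Xs k (act g u).
Proof. by apply: sum_of_act => j /andP[]. Qed.

Lemma Z_subspace k : (1 <= k)%N -> is_subspace (Z_ Xs k).
Proof.
move=> k1; apply: closure_subspace; apply: sum_of_subspace => j kj.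
exact/sXs/(leq_trans k1).
Qed.

Lemma Z_closed k : closed (Z_ Xs k).
Proof. exact: closed_closure. Qed.

Lemma Z_act k g u : (1 <= k)%N -> Z_ Xs k u -> Z_ Xs k (act g u).
Proof.
move=> k1 Zu U /(act_continuous actP isoP) /= /Zu [v [Sv Uv]].
exists (act g v); split => //.
by apply: sum_of_act => // j; exact: leq_trans.
Qed.

Lemma B_act rho k g u : B_ Xs rho k u -> B_ Xs rho k (act g u).
Proof. by move=> [Yu ru]; split; [exact: Y_act|rewrite isoP]. Qed.

(** Fixes the model representation together with a simultaneous choice of isomorphisms [f j] onto
    the [X_j]; nothing is asked of [f 0]. *)
Definition isotypic (V : normedModType R) (actV : G -> V -> V) (f : nat -> V -> X) :=
  [/\ finite_dimensional V, is_action actV, admissible actV &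
   forall j, (1 <= j)%N -> [/\ linear (f j), injective (f j), range (f j) = Xs j &
      forall g v, f j (actV g v) = act g (f j v)]].

Lemma isotypic_exists : exists (V : normedModType R) (actV : G -> V -> V) f,
  isotypic actV f.
Proof.
case: hG0 => _ _ _ _ [_ [V [actV [fdV aV adV iV]]]].
exists V, actV.
have q (j : nat) : exists f : V -> X, (1 <= j)%N ->
   [/\ linear f, injective f, range f = Xs j &
      forall g v, f (actV g v) = act g (f v)].
  case: j => [|j]; first by exists (fun=> 0).
  have [f [injf rf ef]] := iV j.+1 isT.
  exists f => _; split => //; first exact: linearP.
  by move=> g v; exact: ef.
by have [f hf] := choice q; exists f; split.
Qed.

(** * Coordinates of Y_k in V^k, fixed vectors, and the intersection property *)

Section Isotypic.
Variables (V : normedModType R) (actV : G -> V -> V) (f : nat -> V -> X).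
Hypothesis hf : isotypic actV f.

Let fdV : finite_dimensional V. Proof. by case: hf. Qed.
Let linf j : linear (f j.+1). Proof. by case: hf => _ _ _ /(_ j.+1 isT) []. Qed.
Let f_eq0 j v : f j.+1 v = 0 -> v = 0.
Proof.
case: hf => _ _ _ /(_ j.+1 isT) [lf injf _ _] fv0; apply: injf.
by rewrite fv0 (linear_fun0 lf).
Qed.
Let rf j : range (f j.+1) = Xs j.+1.
Proof. by case: hf => _ _ _ /(_ j.+1 isT) []. Qed.
Let fact j g v : f j.+1 (actV g v) = act g (f j.+1 v).
Proof. by case: hf => _ _ _ /(_ j.+1 isT) []. Qed.

(** The equivariant isomorphism of [V^k] onto [Y_k]. Coordinates are numbered from 0 and the [X_j]
    from 1, whence [i.+1]. *)
Definition assemble k (v : 'rV[V]_k) : X := \sum_(i < k) f i.+1 (v ord0 i).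

Lemma assembleB k (v w : 'rV[V]_k) : assemble (v - w) = assemble v - assemble w.
Proof.
rewrite /assemble -sumrB; apply: eq_bigr => i _.
by rewrite !mxE (linear_funB _ _ (linf i)).
Qed.

Lemma assemble0 k : assemble (0 : 'rV[V]_k) = 0.
Proof. by rewrite -(subrr (0 : 'rV[V]_k)) assembleB subrr. Qed.

Lemma assemble_act k g (v : 'rV[V]_k) :
  assemble (diagonal_action actV g v) = act g (assemble v).
Proof.
rewrite /assemble (big_morph (act g)
  (fun x y => linear_funD x y (act_linear actP g)) (linear_fun0 (act_linear actP g))).
by apply: eq_bigr => i _; rewrite mxE fact.
Qed.

Lemma assemble_eq0 k (v : 'rV[V]_k) : assemble v = 0 -> v = 0.
Proof.
move=> v0.
(* The coordinates become a sequence indexed from 1, with 0 beyond [k], as [independent_family]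
   expects. *)
pose x j := f j (if insub j.-1 is Some i then v ord0 i else 0).
have Xx j : (1 <= j)%N -> Xs j (x j).
  by case: j => // j _; rewrite -rf; exists (if insub j is Some i then v ord0 i else 0).
case: hG0 => _ _ _ [ind _] _.
have xi (i : 'I_k) : x i.+1 = f i.+1 (v ord0 i).
  by rewrite /x /= valK.
have := ind k.+1 x Xx; rewrite big_add1 big_mkord /=.
under eq_bigr do rewrite xi.
move=> /(_ v0) xj0; apply/rowP => i; rewrite mxE; apply: (@f_eq0 i).
by rewrite -xi; apply: xj0; rewrite ltnS /= ltnS.
Qed.

Lemma assemble_range k : range (@assemble k) = Y_ Xs k.
Proof.
apply/seteqP; split.
  move=> _ [v _ <-]; apply: subspace_sum => [|i _]; first exact: Y_subspace.
  apply: (@sub_sum_of _ _ _ _ i.+1).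
  - by move=> j /andP[j1 _]; exact: sXs.
  - by rewrite /= ltn_ord.
  - by rewrite -rf; exists (v ord0 i).
apply: sum_of_min.
  split; first by exists 0 => //; apply: big1 => i _; rewrite mxE (linear_fun0 (linf i)).
  move=> a _ _ [v _ <-] [w _ <-]; exists (\row_i (a *: v ord0 i + w ord0 i)) => //.
  rewrite /assemble scaler_sumr -big_split; apply: eq_bigr => i _.
  by rewrite mxE linf.
move=> [|j] // /andP[_ jk]; rewrite -rf => _ [v _ <-].
exists (\row_i (if i == Ordinal jk then v else 0)) => //.
rewrite /assemble (bigD1 (Ordinal jk)) //= mxE eqxx big1 ?addr0 // => i /negPf ij.
by rewrite mxE ij (linear_fun0 (linf i)).
Qed.

Lemma assemble_continuous k : continuous (@assemble k).
Proof.
apply: (@continuous_big _ _ +%R) => [|i _ v].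
  exact: add_continuous.
apply: (@continuous_comp _ _ _ (fun v : 'rV[V]_k => v ord0 i) (f i.+1)); last first.
  exact: finite_dimensional_continuous.
move=> U vU; exists (fun _ j => if j == i then U else setT).
  by move=> i0 j; rewrite (ord1 i0); case: eqP => [->//|_]; exact: filterT.
by move=> w /(_ ord0 i); rewrite eqxx.
Qed.

(** Each of the [k] coordinates is expanded in a basis of [V], which presents [Y_k] as an injective
    image of a real coordinate space, where closedness and compactness are already known. [M]
    recovers bounds on the coordinates in [V]. *)
Lemma assemble_param k : exists n (L : 'rV[R]_n -> X) (M : R),
  [/\ linear L, forall a, L a = 0 -> a = 0, range L = Y_ Xs k, 0 < M &
    forall v : 'rV[V]_k, exists2 a, L a = assemble v &
      forall i, `|v ord0 i| <= M * `|a|].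
Proof.
have [n [E [linE injE surE]]] := finite_dimensional_basis fdV.
pose T (a : 'rV[R]_(k * n)) : 'rV[V]_k := \row_i E (row i (vec_mx a)).
pose L a := assemble (T a).
have [M M0 EM] := linear_rV_bounded linE.
have surT v : exists a, T a = v.
  have [b hb] := choice surE.
  exists (mxvec (\matrix_i b (v ord0 i))); apply/rowP => i0.
  by rewrite mxE mxvecK rowK -hb.
exists (k * n)%N, L, M; split => //.
- move=> c a b; rewrite /L /assemble scaler_sumr -big_split; apply: eq_bigr => i _.
  by rewrite !mxE !linearP /= linE linf.
- move=> a /assemble_eq0 Ta0.
  apply: (can_inj vec_mxK); rewrite linear0; apply/row_matrixP => i.
  rewrite row0; apply: injE.
  by have /rowP/(_ i) := Ta0; rewrite !mxE.
- rewrite -assemble_range; apply/seteqP; split => _ [v _ <-]; first by exists (T v).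
  by have [a <-] := surT v; exists a.
move=> v; have [a <-] := surT v; exists a => // i.
rewrite mxE; apply: le_trans (EM _) _; rewrite ler_pM2l //.
rewrite [leLHS]/Num.norm /= mx_normrE; apply/bigmax_leP; split => // -[i0 j] _ /=.
rewrite !mxE [leRHS]/Num.norm /= mx_normrE.
exact: (le_bigmax _ (fun ij : 'I_1 * 'I_(k * n) => `|a ij.1 ij.2|) (ord0, mxvec_index i j)).
Qed.

Lemma assemble_bound k : exists2 M, 0 < M & forall (v : 'rV[V]_k) i,
  `|v ord0 i| <= M * `|assemble v|.
Proof.
have [n [L [M [linL injL _ M0 LM]]]] := assemble_param k.
have [c c0 Lc] := range_bounded_below linL injL.
exists (M / c) => [|v i]; first by rewrite divr_gt0.
have [a <- /(_ i) va] := LM v; apply: le_trans va _.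
by rewrite -mulrA ler_pM2l // ler_pdivlMl.
Qed.

(** If [v] is fixed, the constant map [v] from the boundary of a ball of [V^2] to [V] is
    equivariant; admissibility provides a zero of it, so [v = 0]. *)
Lemma fixed_V (v : V) : (forall g, actV g v = v) -> v = 0.
Proof.
move=> fixv; have [M M0 fM] := assemble_bound 2.
case: hf => _ aV adV _.
pose U := [set w : 'rV[V]_2 | `|assemble w| < 1].
have invU : invariant_set (diagonal_action actV (k := 2)) U.
  move=> g; apply/seteqP; split => [_ [w Uw <-]|w Uw].
    by rewrite /U /= assemble_act isoP.
  exists (diagonal_action actV g^-1%g w); first by rewrite /U /= assemble_act isoP.
  by apply/rowP => i; rewrite !mxE; case: aV => _ a1 aM _; rewrite -aM mulgV a1.
have oU : open U.
  have -> : U = (fun w => `|assemble w|) @^-1` [set x | x < 1] by [].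
  apply: open_comp => [w _|]; last exact: open_lt.
  by apply: continuous_comp; [exact: assemble_continuous|exact: norm_continuous].
have [||||u _] := adV 2 isT U _ invU oU _ (fun=> const_mx v).
- exists M => w Uw i; apply: le_trans (fM w i) _.
  by rewrite ger_pMr // ltW.
- by rewrite /U /= assemble0 normr0.
- apply: continuous_subspaceT; exact: cst_continuous.
- by move=> g w _; apply/rowP => i; rewrite !mxE fixv.
by move/rowP/(_ ord0); rewrite !mxE.
Qed.

Lemma fixed_Y k u : Y_ Xs k u -> (forall g, act g u = u) -> u = 0.
Proof.
rewrite -assemble_range => -[v _ <-] fixu.
have -> : v = 0.
  apply/rowP => i; rewrite mxE; apply: fixed_V => g.
  have : diagonal_action actV g v - v = 0.
    by apply: assemble_eq0; rewrite assembleB assemble_act fixu subrr.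
  by move=> /rowP/(_ i)/eqP; rewrite !mxE subr_eq0 => /eqP.
exact: assemble0.
Qed.

Lemma Y_closed k : closed (Y_ Xs k).
Proof.
by have [n [L [M [linL injL <- _ _]]]] := assemble_param k; exact: range_closed.
Qed.

Lemma B_compact rho k : compact (B_ Xs rho k).
Proof.
have [n [L [M [linL injL rL _ _]]]] := assemble_param k.
by rewrite /B_ -rL; exact: range_ball_compact.
Qed.

(** Approximate [u] within [e] by a point [x] of some [Y_n]. The barycenter of the orbit of [x] is a
    fixed vector of [Y_n], hence 0, and it is still within [e] of [u] because [u] is fixed. *)
Lemma fixed_X u : (forall g, act g u = u) -> u = 0.
Proof.
move=> fixu; apply/eqP; rewrite -normr_le0; apply/ler_addgt0Pr => e e0.
rewrite add0r.
have dense : closure (sum_of Xs (fun j => (1 <= j)%N)) u.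
  by case: hG0 => _ _ _ [_ ->] _.
have [x [[n [y [Xy xy]]]]] := dense _ (nbhsx_ballx u e e0).
rewrite -ball_normE /= => ux.
have Yx : Y_ Xs n x.
  exists n, y; split; first by move=> j /andP[j1 _]; exact: Xy.
  rewrite xy [RHS]big_nat_cond [LHS]big_nat_cond; apply: eq_bigl => j.
  by case: (ltnP j n) => [jn|]; rewrite ?andbF //= (ltnW jn) andbT.
pose m := average mu act (fun=> x) 0.
have cx : {within [set 0 : X], continuous (fun=> x : X)}.
  by apply: continuous_subspaceT => z; exact: cvg_cst.
have inv0 g w : [set 0 : X] w -> [set 0 : X] (act g w).
  by move=> ->; rewrite /= (linear_fun0 (act_linear actP g)).
have m0 : m = 0.
  apply: (@fixed_Y n); last by move=> g; exact: average_fixed.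
  apply: (average_closed_convex mu cG actP inv0 cx) => //.
  - exact: Y_closed.
  - by apply: subspace_convex; exact: Y_subspace.
  - by move=> g; exact: Y_act.
have : [set z | `|u - z| <= e] m.
  apply: (average_closed_convex mu cG actP inv0 cx) => //.
  - exact: ball_closed.
  - exact: ball_convex.
  - by move=> g /=; rewrite -(fixu g) (act_dist actP isoP) ltW.
by rewrite m0 /= subr0.
Qed.

(** A minimal [L] has its range in [Y_(k-1)] and transverse to [Z_k]. The sum of that range and
    [Z_k] is closed and contains every [X_j], so it is [X]. Transversality forces the chosen
    coefficients to depend on [x] in a Lipschitz way. *)
Lemma selection k : (1 <= k)%N -> exists (P : X -> X) (M : R),
  [/\ 0 < M, forall x, Y_ Xs k.-1 (P x), forall x, Z_ Xs k (x - P x) &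
   forall x y, `|P x - P y| <= M * `|x - y|].
Proof.
move=> k1; have sZ := Z_subspace k1.
have [n [L0 [_ [linL0 _ rL0 _ _]]]] := assemble_param k.-1.
have [||m [L [linL YL LY iL]]] := minimal_parametrization (Y := Y_ Xs k.-1) sZ linL0.
- by move=> a; rewrite -rL0; exists a.
- by move=> y; rewrite -rL0 => -[a _ <-]; exists a; rewrite subrr; exact: sZ.1.
have clW := transverse_sum_closed linL sZ (@Z_closed k) iL.
have sW : is_subspace [set x | exists a, Z_ Xs k (x - L a)].
  split; first by exists 0; rewrite (linear_fun0 linL) subr0; exact: sZ.1.
  move=> c x y [a Za] [b Zb]; exists (c *: a + b).
  have -> : c *: x + y - L (c *: a + b) = c *: (x - L a) + (y - L b).
    by rewrite linL scalerBr opprD addrACA.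
  exact: sZ.2.
have WT x : exists a, Z_ Xs k (x - L a).
  have dense : closure (sum_of Xs (fun j => (1 <= j)%N)) x.
    by case: hG0 => _ _ _ [_ ->] _.
  apply: clW; apply: closure_subset dense; apply: sum_of_min => // j j1 y Xy /=.
  have [jk|kj] := ltnP j k.
    apply: LY; apply: (sub_sum_of _ _ Xy).
      by move=> i /andP[i1 _]; exact: sXs.
    by rewrite j1 /= -ltnS prednK.
  exists 0; rewrite (linear_fun0 linL) subr0; apply: subset_closure.
  by apply: (sub_sum_of _ kj Xy) => i ki; apply: sXs; exact: leq_trans ki.
have [a Za] := choice WT.
have [c c0 Lc] := transverse_bound linL sZ (@Z_closed k) iL.
have [M M0 LM] := linear_rV_bounded linL.
exists (L \o a), (M / c); split => [|x|x|x y] //=; first by rewrite divr_gt0.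
rewrite -(linear_funB _ _ linL); apply: le_trans (LM _) _.
rewrite -mulrA ler_pM2l // ler_pdivlMl //.
have := Lc (a x - a y) (L (a x - a y) - (x - y)); rewrite subKr; apply.
have -> : L (a x - a y) - (x - y) = - ((x - L (a x)) - (y - L (a y))).
  apply: oppr_inj; rewrite opprK (linear_funB _ _ linL) !opprB.
  by rewrite addrACA [RHS]addrACA; congr (_ + _); rewrite addrC.
exact: (subspaceN sZ (subspaceB sZ (Za x) (Za y))).
Qed.

(** The Lipschitz bound of the selection supplies the uniform continuity that averaging needs. Both
    requirements on [Q x] are closed, convex and compatible with the action, so they survive. *)
Lemma equivariant_selection k : (1 <= k)%N -> exists Q : X -> X,
  [/\ continuous Q, forall x, Y_ Xs k.-1 (Q x), forall x, Z_ Xs k (x - Q x) &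
   forall g x, Q (act g x) = act g (Q x)].
Proof.
move=> k1; have [P [M [M0 YP ZP lipP]]] := selection k1.
have ucP e : 0 < e -> exists2 d, 0 < d &
    forall x y, setT x -> setT y -> `|x - y| < d -> `|P x - P y| < e.
  move=> e0; exists (e / M) => [|x y _ _ xy]; first by rewrite divr_gt0.
  by apply: le_lt_trans (lipP x y) _; rewrite mulrC -ltr_pdivlMr.
have cP : {within [set: X], continuous P}.
  apply/within_continuousP => x _ e /ucP [d d0 dP]; exists d => // y _.
  exact: dP.
have invT g (w : X) : setT w -> setT (act g w) by [].
exists (average mu act P); split.
- by rewrite continuous_subspace_setT; exact: (average_continuous cG actP isoP invT cP ucP).
- move=> x; apply: (average_closed_convex mu cG actP invT cP) => //.
  + exact: Y_closed.
  + by apply: subspace_convex; exact: Y_subspace.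
  + by move=> g; exact/Y_act/YP.
- move=> x; apply: (average_closed_convex (C := [set y | Z_ Xs k (x - y)])
    mu cG actP invT cP) => //.
  + have -> : [set y | Z_ Xs k (x - y)] = (fun y => x - y) @^-1` Z_ Xs k by [].
    apply: closed_comp => [y _|]; last exact: Z_closed.
    by apply: cvgB; [exact: cvg_cst|exact: cvg_id].
  + move=> y z a /= Zy Zz _.
    have -> : x - (a *: y + (1 - a) *: z) = a *: (x - y) + (1 - a) *: (x - z).
      by rewrite !scalerBr !scalerBl !scale1r; rewrite addrACA subrKC opprD.
    have sZ := Z_subspace k1.
    exact: (subspaceD sZ (subspaceZ a sZ Zy) (subspaceZ (1 - a) sZ Zz)).
  + move=> g /=; rewrite -{1}(actVK actP g x) -(linear_funB _ _ (act_linear actP g)).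
    exact: Z_act.
- move=> g x; exact: (average_equivariant cG hmu actP isoP invT cP).
Qed.

Definition disassemble k (x : X) : 'rV[V]_k := xget 0 [set v | assemble v = x].

Lemma disassembleK k x : Y_ Xs k x -> assemble (disassemble k x) = x.
Proof.
rewrite -assemble_range => -[v _ vx].
exact: (@xgetI _ 0 [set v | assemble v = x] v vx).
Qed.

Lemma assemble_inj k (v w : 'rV[V]_k) : assemble v = assemble w -> v = w.
Proof.
by move=> vw; apply/eqP; rewrite -subr_eq0; apply/eqP/assemble_eq0; rewrite assembleB vw subrr.
Qed.

Lemma disassemble_act k g x : Y_ Xs k x ->
  disassemble k (act g x) = diagonal_action actV g (disassemble k x).
Proof.
move=> Yx; apply: assemble_inj.
by rewrite assemble_act !disassembleK //; exact: Y_act.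
Qed.

Lemma disassemble_continuous (T : topologicalType) k (A : set T) (h : T -> X) :
  (forall t, Y_ Xs k (h t)) -> {within A, continuous h} ->
  {within A, continuous (fun t => disassemble k (h t))}.
Proof.
move=> Yh; rewrite !subspace_continuousP => ch t At U [N Nt NU].
have [M M0 fM] := assemble_bound k.
have bnd i s : `|disassemble k (h t) ord0 i - disassemble k (h s) ord0 i| <=
    M * `|h t - h s|.
  have := fM (disassemble k (h t) - disassemble k (h s)) i.
  by rewrite !mxE assembleB !disassembleK.
have : \forall s \near within A (nbhs t), forall i : 'I_k,
    N ord0 i (disassemble k (h s) ord0 i).
  apply: filter_forall => i.
  have /nbhs_ballP [e /= e0 eN] := Nt ord0 i.
  have eM : 0 < e / M by rewrite divr_gt0.
  have := ch t At _ (nbhsx_ballx (h t) _ eM); rewrite /= nbhs_simpl /=.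
  apply: filterS => s; rewrite -ball_normE /= => hts.
  apply: eN; rewrite -ball_normE /=; apply: le_lt_trans (bnd i s) _.
  by rewrite mulrC -ltr_pdivlMr.
by apply: filterS => s hs; apply: NU => i0 i; rewrite (ord1 i0).
Qed.

(** Admissibility is applied to [U], the points of [V^k] that represent some [u] with [|u| < rho k]
    and [|gamma u| < r]. A zero of [Q \o gamma] on its boundary sends [gamma u] into [Z_k], and the
    boundary of [U] leaves only [|gamma u| = r]. *)
Lemma intersection k rho r gamma : (2 <= k)%N -> 0 < r < rho k ->
  Theta_ act Xs rho k gamma ->
  exists w, [/\ B_ Xs rho k w, Z_ Xs k (gamma w) & `|gamma w| = r].
Proof.
move=> k2 /andP[r0 rrho] [cg eg idg].
have k1 : (1 <= k)%N by exact: ltnW.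
have [Q [cQ YQ ZQ eQ]] := equivariant_selection k1.
pose A (v : 'rV[V]_k) := assemble v.
have YA v : Y_ Xs k (A v) by rewrite -assemble_range; exists v.
pose D := [set v : 'rV[V]_k | `|A v| <= rho k].
have DB v : D v -> B_ Xs rho k (A v) by [].
have cgA : {within D, continuous (gamma \o A)}.
  rewrite subspace_continuousP => v Dv.
  have := cg; rewrite subspace_continuousP => /(_ _ (DB v Dv)) cgv U /cgv /=.
  rewrite /within /= !nbhs_simpl /= => H.
  have : nbhs v (A @^-1` (fun x => B_ Xs rho k x -> U (gamma x))).
    exact: (@assemble_continuous k v).
  by apply: filterS => w /= hw Dw; apply: hw; exact: DB.
pose U := [set v : 'rV[V]_k | `|A v| < rho k /\ `|gamma (A v)| < r].
have cnA : continuous (fun v => `|A v|).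
  by move=> v; apply: continuous_comp; [exact: assemble_continuous|exact: norm_continuous].
have near_gA v (P : set X) : D v -> nbhs (gamma (A v)) P ->
    \forall w \near v, D w -> P (gamma (A w)).
  by move=> Dv nP; move: cgA; rewrite subspace_continuousP => /(_ v Dv _ nP).
have oU : open U.
  rewrite openE => v [Av gv].
  have Dv : D v by exact: ltW.
  have nb : \forall w \near v, `|A w| < rho k.
    exact: (cvgr_lt _ (cnA v)).
  have ng : \forall w \near v, D w -> `|gamma (A w)| < r.
    apply: (near_gA v [set x | `|x| < r]) => //.
    exact: (cvgr_lt _ (@norm_continuous _ _ (gamma (A v)))).
  apply: filterS (filterI nb ng) => w [Aw gw]; split => //.
  by apply: gw; exact: ltW.
(* Equivariance makes [gamma 0] a fixed vector of [X]; this puts 0 in [U]. *)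
have gA0 : gamma (A 0) = 0.
  have A0 : A 0 = 0 by exact: assemble0.
  apply: fixed_X => g; rewrite -eg; last first.
    by apply: DB; rewrite /D /= A0 normr0 ltW // (lt_trans r0).
  by rewrite A0 (linear_fun0 (act_linear actP g)).
have invU : invariant_set (diagonal_action actV (k := k)) U.
  have actU g v : U v -> U (diagonal_action actV g v).
    move=> [Av gv]; split; rewrite /A assemble_act ?isoP //.
    by rewrite eg ?isoP //; apply: DB; exact: ltW.
  move=> g; apply/seteqP; split => [_ [w Uw <-]|w Uw]; first exact: actU.
  exists (diagonal_action actV g^-1%g w); first exact: actU.
  apply/rowP => i; rewrite !mxE.
  by case: hf => _ [_ a1 aM _] _ _; rewrite -aM mulgV a1.
have clU v : closure U v -> D v /\ `|gamma (A v)| <= r.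
  move=> cUv; have Dv : D v.
    rewrite /D /= leNgt; apply/negP => rv.
    have nb : \forall w \near v, rho k < `|A w| by exact: (cvgr_gt _ (cnA v)).
    by have [w [[/ltW Aw _]]] := cUv _ nb; rewrite /= ltNge Aw.
  split => //; rewrite leNgt; apply/negP => rv.
  have ng : \forall w \near v, D w -> r < `|gamma (A w)|.
    apply: (near_gA v [set x | r < `|x|]) => //.
    exact: (cvgr_gt _ (@norm_continuous _ _ (gamma (A v)))).
  have [w [[Aw gw]]] := cUv _ ng => /= /(_ (ltW Aw)).
  by rewrite ltNge (ltW gw).
have bdD : boundary U `<=` D by move=> v [/clU []].
have [||||v [cUv nUv] gv] := (let: And4 _ _ ad _ := hf in ad) k k2 U _ invU oU _
    (fun v => disassemble k.-1 (Q (gamma (A v)))).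
- have [M M0 fM] := assemble_bound k.
  exists (M * rho k) => v [Av _] i; apply: le_trans (fM v i) _.
  by rewrite ler_pM2l // ltW.
- split; first by rewrite /A assemble0 normr0 (lt_trans r0).
  by rewrite gA0 normr0.
- apply: disassemble_continuous => [v|]; first exact: YQ.
  apply: (continuous_subspaceW bdD).
  by move: cgA; rewrite !subspace_continuousP => cgA v Dv; apply: cvg_comp (cgA v Dv) (cQ _).
- move=> g v /bdD Dv /=; rewrite -disassemble_act; last exact: YQ.
  by rewrite -eQ -eg ?/A ?assemble_act //; exact: DB.
have [Dv gr] := clU _ cUv.
have Qv : Q (gamma (A v)) = 0.
  by rewrite -(disassembleK (YQ (gamma (A v)))) gv assemble0.
exists (A v); split; [exact: DB| |].
  by have := ZQ (gamma (A v)); rewrite Qv subr0.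
(* A boundary point with [|gamma u| < r] must have [|u| = rho k]; there [gamma] is the identity and
   [|gamma u| = rho k > r]. *)
apply/eqP; rewrite eq_le gr /= leNgt; apply/negP => gvr.
have Avrho : `|A v| = rho k.
  apply/eqP; rewrite eq_le Dv /= leNgt; apply/negP => Avr.
  by apply: nUv; apply: open_nbhs_nbhs; split.
by move: gvr; rewrite idg // Avrho ltNge ltW.
Qed.

End Isotypic.
End Geometry.

(** * Ordering principle, gluing, and C1 functionals *)

(** Each term of a descending sequence goes at least halfway to the infimum of [F] below its
    predecessor, so nothing is left to gain below a lower bound of the whole sequence. *)
Lemma order_minimal (R : realType) (T : Type) (D : set T) (le : T -> T -> Prop)
    (F : T -> R) (m : R) :
  (forall x, D x -> le x x) ->
  (forall x y z, le z y -> le y x -> le z x) ->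
  (forall x y, D x -> D y -> le y x -> F y <= F x) ->
  (forall x, D x -> m <= F x) ->
  (forall u : nat -> T, (forall n, D (u n)) -> (forall n, le (u n.+1) (u n)) ->
    exists2 x, D x & forall n, le x (u n)) ->
  forall x0, D x0 -> exists x, [/\ D x, le x x0 & forall y, D y -> le y x -> F y = F x].
Proof.
move=> refl trans mono bnd low x0 Dx0.
have nxt x : exists z, D x -> [/\ D z, le z x &
    forall y, D y -> le y x -> F z <= (F x + F y) / 2].
  have [Dx|nDx] := pselect (D x); last by exists x.
  pose S := F @` [set y | D y /\ le y x].
  have hS : has_inf S.
    split; first by exists (F x), x => //; split => //; exact: refl.
    by exists m => _ [y [Dy _] <-]; exact: bnd.
  have iS y : D y -> le y x -> inf S <= F y.
    by move=> Dy yx; apply: ge_inf; [case: hS|exists y].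
  (* If [F x] already is the infimum, no strictly better point exists and [x] is its own
     successor. *)
  have := iS x Dx (refl x Dx); rewrite le_eqVlt => /predU1P[Fx|Fx].
    exists x => _; split => // [|y Dy yx]; first exact: refl.
    by have := iS y Dy yx; rewrite Fx; lra.
  have [_ [z [Dz zx] <-] Fz] : exists2 a, S a & a < (F x + inf S) / 2.
    have e0 : 0 < (F x - inf S) / 2 by lra.
    have [a Sa ae] := inf_adherent e0 hS; exists a => //.
    by apply: lt_le_trans ae _; lra.
  by exists z => _; split => // y Dy yx; have := iS y Dy yx; lra.
have [nx hnx] := choice nxt.
pose u n := iter n nx x0.
have Du n : D (u n) by elim: n => // n /hnx [].
have [x Dx xu] := low u Du (fun n => let: And3 _ h _ := hnx _ (Du n) in h).
exists x; split => //; first exact: (xu 0%N).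
move=> y Dy yx; apply/eqP; rewrite eq_le mono //=.
pose A := range (F \o u).
have A0 : A !=set0 by exists (F (u 0%N)), 0%N.
have Fxl : F x <= inf A.
  by apply: lb_le_inf => // _ [n _ <-]; apply: mono.
apply: le_trans Fxl _.
(* As [y] lies below every [u n], the choice of [u n.+1] reads [2 F (u n.+1) - F y <= F (u n)]; then
   take the infimum over [n]. *)
suff : 2 * inf A - F y <= inf A by lra.
apply: lb_le_inf => // _ [n _ <-] /=.
have : inf A <= F (u n.+1).
  apply: ge_inf; last by exists n.+1.
  by exists m => _ [k _ <-]; exact: bnd.
have [_ _ /(_ y Dy (trans _ _ _ yx (xu n)))] := hnx _ (Du n).
by rewrite /u /=; lra.
Qed.

(** The glued map is a convex combination, at each [w], of those local maps that are valid at [w].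
    Finitely many of them suffice, so the smallness required of [s] becomes uniform on [K]. *)
Lemma convex_glue (R : realType) (X Y : normedModType R) (K : set X)
    (P : R -> X -> Y -> Prop) :
  compact K -> (forall s w, convex_subset [set y | P s w y]) ->
  (forall w0, K w0 -> exists2 f : X -> Y, {within K, continuous f} &
     \forall w \near w0 & s \near 0^'+, K w -> P s w (f w)) ->
  exists2 F : X -> Y, {within K, continuous F} &
    \forall s \near 0^'+, forall w, K w -> P s w (F w).
Proof.
move=> cK cvP loc.
have q w0 : exists p : (X -> Y) * R, K w0 -> [/\ {within K, continuous p.1}, 0 < p.2 &
    \forall s \near 0^'+, forall w, `|w0 - w| < p.2 -> K w -> P s w (p.1 w)].
  have [Kw|nKw] := pselect (K w0); last by exists (fun=> 0, 0).
  have [f cf [[A B] /= [/nbhs_ballP [d /= d0 dA] nB] AB]] := loc w0 Kw.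
  exists (f, d) => _; split => //; apply: filterS nB => s Bs w wd.
  by apply: (AB (w, s)); split => //; apply: dA; rewrite -ball_normE.
have [p hp] := choice q.
have [l [lK lcov]] := compact_finite_nbhs (N := fun w => ball w (p w).2) cK
  (fun w Kw => nbhsx_ballx w _ (let: And3 _ h _ := hp w Kw in h)).
pose y (i : 'I_(size l)) := nth 0 l i.
have Ky i : K (y i) by apply: lK; exact: mem_nth.
(* Tent functions, positive exactly on the balls where the corresponding local map is controlled;
   after division by their sum they form a partition of unity on [K]. *)
pose sg i w : R := Num.max 0 ((p (y i)).2 - `|y i - w|).
have sg0 i w : 0 <= sg i w by rewrite le_max lexx.
have sgP i w : 0 < sg i w -> `|y i - w| < (p (y i)).2.
  by rewrite lt_max ltxx /= subr_gt0.
have sgK w : K w -> 0 < \sum_(i < size l) sg i w.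
  move=> Kw; have [z zl] := lcov w Kw; rewrite -ball_normE /= => zw.
  have hz : (index z l < size l)%N by rewrite index_mem.
  rewrite (bigD1 (Ordinal hz)) //= ltr_pwDl ?sumr_ge0 //.
  by rewrite lt_max /y /= nth_index // subr_gt0 zw orbT.
have csg i w : K w -> sg i w' @[w' --> within K (nbhs w)] --> sg i w.
  move=> Kw; apply: cvg_within_filter.
  apply: (@continuous_max _ _ (fun=> 0) (fun w => (p (y i)).2 - `|y i - w|) w).
    exact: cvg_cst.
  by apply: cvgB; [exact: cvg_cst|apply: cvg_norm; apply: cvgB; [exact: cvg_cst|exact: cvg_id]].
exists (fun w => (\sum_(i < size l) sg i w)^-1 *: \sum_(i < size l) sg i w *: (p (y i)).1 w).
  rewrite subspace_continuousP => w Kw.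
  apply: cvgZ.
    apply: cvgV; first by rewrite gt_eqF // sgK.
    apply: (cvg_big (op := +%R)) => [|i _]; first exact: add_continuous.
    exact: csg.
  apply: (cvg_big (op := +%R)) => [|i _]; first exact: add_continuous.
  apply: cvgZ; first exact: csg.
  have [cf _ _] := hp _ (Ky i).
  by move: cf; rewrite subspace_continuousP; apply.
have : \forall s \near 0^'+, forall i w, `|y i - w| < (p (y i)).2 -> K w ->
    P s w ((p (y i)).1 w).
  by apply: filter_forall => i; have [] := hp _ (Ky i).
apply: filterS => s hs w Kw.
apply: (@convex_sum _ _ [set z | P s w z] _ _ (fun i => sg i w)) => //.
- by move=> i /sgP yi; exact: hs.
- exact: sgK.
Qed.

Section C1.
Variables (R : realType) (X : normedModType R) (Phi : X -> R).
Hypothesis hPhi : C1_functional Phi.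

Lemma C1_continuous : continuous Phi.
Proof. by move=> u; apply: differentiable_continuous; exact: hPhi.1. Qed.

Lemma C1_diff_continuous : continuous (fun p : X * X => 'd Phi (p.1) (p.2)).
Proof.
move=> [u h]; apply/cvgrPdist_lt => e e0.
have e2 : 0 < e / 2 by rewrite divr_gt0.
have c0 : 0 < e / 2 / (`|h| + 1) by rewrite divr_gt0 // ltr_wpDl.
have H1 := hPhi.2 u _ c0.
have cd : continuous ('d Phi u) by apply: diff_continuous; exact: hPhi.1.
have /cvgrPdist_lt /(_ _ e2) H2 := cd h.
have H3 : \forall h' \near h, `|h'| < `|h| + 1.
  by apply: (cvgr_lt _ (@norm_continuous _ _ h)); rewrite ltrDl.
exists ([set w | forall h0, `|'d Phi w h0 - 'd Phi u h0| <= e / 2 / (`|h| + 1) * `|h0|],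
  [set h' | `|'d Phi u h - 'd Phi u h'| < e / 2 /\ `|h'| < `|h| + 1]).
  by split => //; exact: filterI.
move=> [w h'] /= [wu [hh' h'1]].
rewrite -(subrKA ('d Phi u h')); apply: le_lt_trans (ler_normD _ _) _.
rewrite [ltRHS]splitr; apply: ltr_leD => //; rewrite distrC.
apply: le_trans (wu h') _.
by rewrite mulrAC ler_pdivrMr ?ltr_wpDl // ler_wpM2l // ltW.
Qed.

Lemma C1_mvt v h : exists2 c : R, 0 <= c <= 1 & Phi (v + h) - Phi v = 'd Phi (v + c *: h) h.
Proof.
pose phi (t : R) := Phi (v + t *: h).
have dphi (t : R) : is_derive t 1 phi ('d Phi (v + t *: h) h).
  have dd : is_derive (v + t *: h) h Phi ('d Phi (v + t *: h) h).
    by apply: DeriveDef; [exact/diff_derivable/hPhi.1|exact/deriveE/hPhi.1].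
  have e : (fun s : R => s^-1 *: ((phi \o shift t) (s *: (1 : R)) - phi t)) =
      (fun s : R => s^-1 *: ((Phi \o shift (v + t *: h)) (s *: h) - Phi (v + t *: h))).
    apply/funext => s; rewrite /phi /= ; congr (_ *: (Phi _ - _)).
    by rewrite [s *: 1]mulr1 scalerDl addrCA.
  by case: dd => d1 d2; apply: DeriveDef; rewrite /derivable /derive e.
have [|c] := @MVT_segment R phi (fun t => 'd Phi (v + t *: h) h) 0 1 ler01.
  by apply: derivable_within_continuous => t _; case: (dphi t).
by rewrite in_itv /= => c01; rewrite /phi scale1r scale0r addr0 subr0 mulr1; exists c.
Qed.

(** By the mean value theorem the remainder is a difference of two derivatives applied to [h]. Each
    is compared, within [e / 2], with the derivative at the centre of a ball of the cover. *)
Lemma C1_uniform (A : set X) (e : R) : compact A -> 0 < e ->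
  \forall s \near 0^'+, forall u, A u -> forall h, `|h| <= s ->
    `|Phi (u + h) - Phi u - 'd Phi u h| <= e * `|h|.
Proof.
move=> cA e0; have e2 : 0 < e / 2 by rewrite divr_gt0.
apply: (compact_near_coveringP A).1 => // u Au.
have /nbhs_ballP [d /= d0 dP] := hPhi.2 u _ e2.
have d2 : 0 < d / 2 by rewrite divr_gt0.
near=> v s => h hs.
have uv : `|u - v| < d / 2.
  by near: v; have := nbhsx_ballx u _ d2; rewrite -ball_normE.
have sd : s <= d / 2 by near: s; exact: nbhs_right_le.
have [c /andP[c0 c1] ->] := C1_mvt v h.
rewrite -(subrKA ('d Phi u h)); apply: le_trans (ler_normD _ _) _.
rewrite [e]splitr mulrDl; apply: lerD.
  apply: dP; rewrite -ball_normE /= opprD addrA.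
  apply: le_lt_trans (ler_normB _ _) _; rewrite [d]splitr; apply: ltr_leD => //.
  rewrite normrZ ger0_norm //; apply: le_trans (le_trans hs sd).
  by rewrite ler_piMl.
rewrite distrC; apply: dP; rewrite -ball_normE /=.
by apply: lt_trans uv _; lra.
Unshelve. all: end_near. Qed.

End C1.

(** * Minimax over equivariant maps *)

Lemma near_prod (T U : Type) (F : set_system T) (H : set_system U)
    (A : set T) (B : set U) (P : T -> U -> Prop) :
  F A -> H B -> (forall t u, A t -> B u -> P t u) ->
  filter_prod F H [set p | P p.1 p.2].
Proof. by move=> FA HB AB; exists (A, B) => // -[t u] [/= At Bu]; exact: AB. Qed.

Section ConvexLsc.
Variables (R : realType) (X : normedModType R) (Psi : X -> \bar R).
Hypotheses (Psi_ninfty : forall u, Psi u <> -oo%E) (Psi_convex : ereal_convex Psi)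
  (Psi_lsc : lower_semicontinuous Psi).

Lemma Psi_between u (a : R) : (a%:E < Psi u)%E -> exists2 b : R, a < b & (b%:E < Psi u)%E.
Proof.
case: (Psi u) => [r| |] //; rewrite ?lte_fin => ar.
  by exists ((a + r) / 2); rewrite ?lte_fin; lra.
by exists (a + 1); rewrite ?ltrDl // ltry.
Qed.

Lemma Psi_near u (a : R) : (a%:E < Psi u)%E -> \forall v \near u, (a%:E < Psi v)%E.
Proof. by move=> /Psi_lsc [V nV hV]; apply: filterS nV => v /hV. Qed.

(** The bound varies with the point because the descent condition compares [Psi] with an affine
    function, not with a constant. *)
Lemma sublevel_closed (b : X -> R) : continuous b -> closed [set x | (Psi x <= (b x)%:E)%E].
Proof.
move=> cb; rewrite -openC openE => x /= /negP; rewrite -ltNge => /Psi_between [r br rP].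
have n1 := Psi_near rP.
have n2 : \forall y \near x, b y < r by exact: (cvgr_lt _ (cb x)).
apply: filterS (filterI n1 n2) => y [ry yr] /=; apply/negP; rewrite -ltNge.
by apply: lt_trans ry; rewrite lte_fin.
Qed.

Lemma Psi_convex_le x y (a p q : R) : 0 <= a <= 1 -> (Psi x <= p%:E)%E -> (Psi y <= q%:E)%E ->
  (Psi (a *: x + (1 - a) *: y)%R <= (a * p + (1 - a) * q)%:E)%E.
Proof.
move=> a01 xp yq; apply: le_trans (Psi_convex x y a01) _.
case/andP: a01 => a0 a1; rewrite (EFinD (a * p)) (EFinM a) (EFinM (1 - a)); apply: leeD.
  by apply: lee_wpmul2l; rewrite ?lee_fin.
by apply: lee_wpmul2l; rewrite ?lee_fin // subr_ge0.
Qed.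

Lemma sublevel_convex (b : X -> R) :
  (forall x y a, b (a *: x + (1 - a) *: y) = a * b x + (1 - a) * b y) ->
  convex_subset [set x | (Psi x <= (b x)%:E)%E].
Proof. by move=> bP x y a /= xb yb a01; rewrite bP; exact: Psi_convex_le. Qed.

Lemma Psi_fine u (a : R) : (Psi u <= a%:E)%E -> Psi u = (fine (Psi u))%:E.
Proof. by have := @Psi_ninfty u; case: (Psi u). Qed.

Lemma functional_le (Phi : X -> R) u (a : R) :
  (functional Phi Psi u <= a%:E)%E = (Psi u <= (a - Phi u)%:E)%E.
Proof.
rewrite /functional; have := @Psi_ninfty u; case: (Psi u) => [r| |] //= _.
by rewrite -EFinD !lee_fin lerBrDl.
Qed.

Lemma functional_between (Phi : X -> R) u (a : R) : (a%:E < functional Phi Psi u)%E ->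
  exists2 b : R, a < b & (b%:E < functional Phi Psi u)%E.
Proof.
rewrite ltNge functional_le -ltNge => /Psi_between [b ab bP].
exists (b + Phi u); first by lra.
by rewrite ltNge functional_le -ltNge addrK.
Qed.

Lemma functional_near (Phi : X -> R) u (a : R) : continuous Phi ->
  (a%:E < functional Phi Psi u)%E -> \forall v \near u, (a%:E < functional Phi Psi v)%E.
Proof.
move=> cPhi; rewrite ltNge functional_le -ltNge => /(Psi_between) [b ab bP].
have n1 := Psi_near bP.
have n2 : \forall v \near u, a - b < Phi v by apply: (cvgr_gt _ (cPhi u)); lra.
apply: filterS (filterI n1 n2) => v [bv av].
by rewrite ltNge functional_le -ltNge; apply: lt_trans bv; rewrite lte_fin; lra.
Qed.

End ConvexLsc.

(** By linearity of the action the two difference quotients coincide before any limit is taken. *)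
Lemma diff_invariant (R : realType) (X : normedModType R) (G : Type)
    (act : G -> X -> X) (Phi : X -> R) g u h :
  linear (act g) -> (forall v, Phi (act g v) = Phi v) -> C1_functional Phi ->
  'd Phi (act g u) (act g h) = 'd Phi u h.
Proof.
move=> lg inv [dPhi _].
rewrite -!deriveE // /derive.
have -> : (fun s => s^-1 *: ((Phi \o shift (act g u)) (s *: act g h) - Phi (act g u))) =
    (fun s => s^-1 *: ((Phi \o shift u) (s *: h) - Phi u)) :> (R -> R) => //.
by apply/funext => s /=; rewrite -lg !inv.
Qed.

Section Minimax.
Variables (R : realType) (X : completeNormedModType R).
Variables (G : topologicalGroupType) (mu : probability (borel G) R).
Variables (act : G -> X -> X) (Phi : X -> R) (Psi : X -> \bar R).
Hypotheses (cG : compact [set: G]) (hmu : is_haar mu).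
Hypotheses (actP : is_action act) (isoP : isometric_action act).
Hypotheses (hPhi : C1_functional Phi)
  (Psi_ninfty : forall u, Psi u <> -oo%E)
  (Psi_convex : ereal_convex Psi)
  (Psi_lsc : lower_semicontinuous Psi)
  (Phi_inv : invariant_functional act Phi)
  (Psi_inv : invariant_functional act Psi).

Let I := functional Phi Psi.

Let I_le u (a : R) : (I u <= a%:E)%E = (Psi u <= (a - Phi u)%:E)%E.
Proof. exact: functional_le. Qed.

(* [K] and [D] stand for [B_k] and its boundary sphere, [rad] for the radial
   projection onto that sphere. *)
Variables (K D : set X) (rad : X -> X).
Hypotheses (cK : compact K) (K_act : forall g w, K w -> K (act g w)).
Hypotheses (DK : D `<=` K) (cD : closed D) (D_act : forall g w, D w -> D (act g w)).
Hypotheses (crad : continuous rad) (radD : forall w, D w -> rad w = w)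
  (I_rad : forall w0, D w0 -> \forall w \near w0, K w -> (I (rad w) <= 0)%E).

Definition equivariant_maps : set (X -> X) :=
  [set gamma | [/\ {within K, continuous gamma}, equivariant_on act act K gamma &
                   forall u, D u -> gamma u = u]].

Definition sup_level (gamma : X -> X) : \bar R := ereal_sup [set I (gamma w) | w in K].

Variable c : R.
Hypothesis c_inf : ereal_inf [set sup_level gamma | gamma in equivariant_maps] = c%:E.

(** On these maps the level is a real number, since [c] bounds it below. *)
Definition finite_maps := [set gamma | equivariant_maps gamma /\ (sup_level gamma < +oo)%E].

Definition level gamma : R := fine (sup_level gamma).

Lemma c_le_sup_level gamma : equivariant_maps gamma -> (c%:E <= sup_level gamma)%E.
Proof. by move=> h; rewrite -c_inf; apply: ereal_inf_lbound; exists gamma. Qed.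

Lemma levelE gamma : finite_maps gamma -> sup_level gamma = (level gamma)%:E.
Proof.
move=> [/c_le_sup_level]; rewrite /level; case: (sup_level gamma) => //.
Qed.

Lemma c_le_level gamma : finite_maps gamma -> c <= level gamma.
Proof. by move=> h; rewrite -lee_fin -levelE //; apply: c_le_sup_level; case: h. Qed.

Lemma I_le_level gamma w : finite_maps gamma -> K w -> (I (gamma w) <= (level gamma)%:E)%E.
Proof. by move=> h Kw; rewrite -levelE //; apply: ereal_sup_ubound; exists w. Qed.

Lemma level_le gamma (a : R) : equivariant_maps gamma ->
  (forall w, K w -> (I (gamma w) <= a%:E)%E) -> finite_maps gamma /\ level gamma <= a.
Proof.
move=> h ha; have la : (sup_level gamma <= a%:E)%E.
  by apply: ge_ereal_sup => _ [w Kw <-]; exact: ha.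
 have fg : finite_maps gamma by split => //; apply: le_lt_trans la _; rewrite ltry.
by split => //; rewrite -lee_fin -levelE.
Qed.

(** Over an empty [K] every supremum would be [-oo], and with no equivariant map the infimum would
    be [+oo]; [c] is real. *)
Lemma K_nonempty : K !=set0.
Proof.
apply/set0P/eqP => K0.
have [_ [gamma h _]] : [set sup_level gamma | gamma in equivariant_maps] !=set0.
  apply/set0P/eqP => S0; have := c_inf; rewrite S0 ereal_inf0 => //.
by have := c_le_sup_level h; rewrite /sup_level K0 image_set0 ereal_sup0.
Qed.

Variable delta : R.
Hypotheses (delta0 : 0 < delta) (delta_c : 2 * delta < c).

(** A bound on the uniform distance over [K], stated pointwise so that no supremum of norms
    occurs. *)
Definition below (eta gamma : X -> X) :=
  forall w, K w -> delta * `|eta w - gamma w| <= level gamma - level eta.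

Lemma below_trans x y z : below z y -> below y x -> below z x.
Proof.
move=> zy yx w Kw; have := zy w Kw; have := yx w Kw => h1 h2.
rewrite -(subrKA (y w)); apply: (@le_trans _ _ (delta * (`|z w - y w| + `|y w - x w|))).
  by rewrite ler_pM2l // ler_normD.
by rewrite mulrDr; lra.
Qed.

Lemma below_level x y : below y x -> level y <= level x.
Proof.
move=> yx; have [w Kw] := K_nonempty; rewrite -subr_ge0; apply: le_trans (yx w Kw).
by rewrite mulr_ge0 // ltW.
Qed.

(** The levels decrease and are bounded below by [c], so the order makes the sequence uniformly
    Cauchy on [K]. The uniform limit inherits continuity, equivariance and the boundary values;
    lower semicontinuity of [I] controls its level. *)
Lemma below_limit (u : nat -> X -> X) : (forall n, finite_maps (u n)) ->
  (forall n, below (u n.+1) (u n)) -> exists2 x, finite_maps x & forall n, below x (u n).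
Proof.
move=> fu bu.
have bmn n m : (n <= m)%N -> below (u m) (u n).
  move=> /subnK <-; elim: (m - n)%N => [|i IH] /=.
    by move=> w _; rewrite !subrr normr0 mulr0.
  by apply: below_trans IH; exact: bu.
pose L := range (fun n => level (u n)).
have hL : has_inf L.
  split; first by exists (level (u 0%N)), 0%N.
  by exists c => _ [n _ <-]; exact: c_le_level.
pose l := inf L.
have lL n : l <= level (u n) by apply: ge_inf; [case: hL|exists n].
have close n m w : K w -> (n <= m)%N -> `|u m w - u n w| <= (level (u n) - l) / delta.
  move=> Kw nm; rewrite ler_pdivlMr // mulrC; apply: le_trans (bmn n m nm w Kw) _.
  by rewrite lerD2l lerN2.
have small e : 0 < e -> exists n, (level (u n) - l) / delta < e.
  move=> e0; have de0 : 0 < delta * e by rewrite mulr_gt0.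
  have [_ [n _ <-] ne] := inf_adherent de0 hL.
  by exists n; rewrite ltr_pdivrMr // mulrC ltrBlDl.
have cu w : K w -> cvg (u n w @[n --> \oo]).
  move=> Kw; apply/cauchy_cvgP/cauchy_exP => e /small [n ne].
  exists (u n w); exists n => // m /= nm; rewrite -ball_normE /= distrC.
  by apply: le_lt_trans (close n m w Kw nm) ne.
pose x w := lim (u n w @[n --> \oo]).
have xu n w : K w -> `|x w - u n w| <= (level (u n) - l) / delta.
  move=> Kw.
  have cv : (fun m => `|u m w - u n w|) @ \oo --> `|x w - u n w|.
    by apply: cvg_norm; apply: cvgB; [exact: cu|exact: cvg_cst].
  rewrite -(cvg_lim _ cv) //; apply: limr_le; first by apply/cvg_ex; exists `|x w - u n w|.
  by exists n => // m /= nm; exact: close.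
have zero (a b : X) : (forall e, 0 < e -> `|a - b| <= e) -> a = b.
  move=> h; apply/eqP; rewrite -subr_eq0 -normr_le0; apply/ler_addgt0Pr => e e0.
  by rewrite add0r; exact: h.
have Ex : equivariant_maps x.
  split.
  - apply/within_continuousP => w Kw e e0.
    have e3 : 0 < e / 3 by rewrite divr_gt0.
    have [n ne] := small _ e3; have [[cn _ _] _] := fu n.
    move: cn => /within_continuousP /(_ w Kw _ e3) [d d0 dn].
    exists d => // v Kv wv.
    have -> : x w - x v = (x w - u n w) + (u n w - u n v) - (x v - u n v).
      by rewrite opprB !subrKA.
    apply: le_lt_trans (ler_normB _ _) _.
    apply: le_lt_trans (lerD (ler_normD _ _) (xu n v Kv)) _.
    by have := xu n w Kw; have := dn v Kv wv; lra.
  - move=> g w Kw; apply: zero => e e0.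
    have e2 : 0 < e / 2 by rewrite divr_gt0.
    have [n ne] := small _ e2; have [[_ en _] _] := fu n.
    rewrite -(subrKA (u n (act g w))); apply: le_trans (ler_normD _ _) _.
    rewrite {2}en // (act_dist actP isoP) (distrC (u n w)).
    by have := xu n w Kw; have := xu n _ (K_act g Kw); lra.
  - move=> w Dw; apply: zero => e e0.
    have [n ne] := small _ e0; have [[_ _ idn] _] := fu n.
    by have := xu n w (DK Dw); rewrite idn //; lra.
have [fx lx] : finite_maps x /\ level x <= l.
  apply: level_le => // w Kw; rewrite leNgt; apply/negP => lI.
  have [a la aI] := functional_between Psi_ninfty lI.
  have /nbhs_ballP [d /= d0 dI] := functional_near Psi_ninfty Psi_lsc (C1_continuous hPhi) aI.
  (* The first bound puts [u n w] in the ball where [I > a]; the second gives [level (u n) < a], a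
     contradiction. *)
  have m0 : 0 < Num.min d ((a - l) / delta) by rewrite lt_min d0 divr_gt0 // subr_gt0.
  have [n] := small _ m0; rewrite lt_min => /andP[nd na].
  have : (a%:E < I (u n w))%E.
    by apply: dI; rewrite -ball_normE /=; apply: le_lt_trans (xu n w Kw) nd.
  rewrite ltNge => /negP; apply; apply: le_trans (I_le_level (fu n) Kw) _.
  by rewrite lee_fin; move: na; rewrite ltr_pM2r ?invr_gt0 //; lra.
exists x => // n w Kw; have := xu n w Kw; rewrite ler_pdivlMr // mulrC => h.
by apply: le_trans h _; rewrite lerD2l lerN2.
Qed.

(** * Deformation of a map that meets no almost critical point *)

Section Deformation.
Variable gamma : X -> X.
Hypothesis fg : finite_maps gamma.

Let M := level gamma.
Let p w := fine (Psi (gamma w)).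

Let cg : {within K, continuous gamma}. Proof. by case: fg => -[]. Qed.
Let eg : equivariant_on act act K gamma. Proof. by case: fg => -[]. Qed.
Let idg : forall u, D u -> gamma u = u. Proof. by case: fg => -[]. Qed.
Let cM : c <= M. Proof. exact: c_le_level. Qed.

Let Psi_p w : K w -> Psi (gamma w) = (p w)%:E.
Proof.
by move=> Kw; have := I_le_level fg Kw; rewrite I_le; exact: Psi_fine.
Qed.

Let Phi_p w : K w -> Phi (gamma w) + p w <= M.
Proof.
by move=> Kw; have := I_le_level fg Kw; rewrite I_le Psi_p // lee_fin lerBrDl.
Qed.

(** The last clause says that [I], with [Phi] linearized at [gamma w], falls to [M - 2 delta s]
    after a step [s] in direction [y]. All three clauses are convex in [y], and [y = 0] on [D]
    preserves the boundary condition. *)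
Definition descent (s : R) (w y : X) := [/\ `|y| <= 1, D w -> y = 0 &
  (Psi (gamma w + s *: y)%R <=
    (M - 2 * delta * s - Phi (gamma w) - s * 'd Phi (gamma w) y)%:E)%E].

Lemma descent_convex s w : convex_subset [set y | descent s w y].
Proof.
move=> x y a [x1 xD xP] [y1 yD yP] a01; have /andP[a0 a1] := a01; split.
- have := @ball_convex _ _ 0 1 x y a; rewrite /= !sub0r !normrN; exact.
- by move=> Dw; rewrite xD // yD // !scaler0 addr0.
have -> : gamma w + s *: (a *: x + (1 - a) *: y) =
    a *: (gamma w + s *: x) + (1 - a) *: (gamma w + s *: y).
  rewrite !scalerDr addrACA -scalerDl subrKC scale1r.
  by rewrite !scalerA [s * a]mulrC [s * (1 - a)]mulrC.
apply: le_trans (Psi_convex_le Psi_convex a01 xP yP) _.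
rewrite lee_fin linearD !linearZ /= !/(_ *: _) /=.
by lra.
Qed.

Lemma descent_target s t w v q : K w -> 0 <= s -> 0 <= s * t <= 1 ->
  t * `|v - gamma w| <= 1 -> 0 <= t ->
  (D w -> v = gamma w) -> (Psi v <= q%:E)%E ->
  Phi (gamma w) + p w + s * t * ('d Phi (gamma w) (v - gamma w) + q - p w)
    <= M - 2 * delta * s ->
  descent s w (t *: (v - gamma w)).
Proof.
move=> Kw s0 st tv t0 Dv Pv h; split.
- by rewrite normrZ ger0_norm.
- by move=> /Dv ->; rewrite subrr scaler0.
have -> : gamma w + s *: (t *: (v - gamma w)) = (s * t) *: v + (1 - s * t) *: gamma w.
  by rewrite scalerA scalerBr scalerBl scale1r addrCA addrA addrAC.
have Pw : (Psi (gamma w) <= (p w)%:E)%E by rewrite Psi_p.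
apply: le_trans (Psi_convex_le Psi_convex st Pv Pw) _.
have -> : 'd Phi (gamma w) (t *: (v - gamma w)) = t * 'd Phi (gamma w) (v - gamma w).
  exact: linearZ.
by rewrite lee_fin; move: h; set b := 'd Phi _ _; lra.
Qed.

Hypothesis no_almost_critical : forall w, K w ->
  ((c - 2 * delta)%:E <= I (gamma w))%E ->
  exists v, ~ ((- (4 * delta * `|v - gamma w|))%R%:E <=
     ('d Phi (gamma w) (v - gamma w)%R)%:E + Psi v - Psi (gamma w))%E.

Let cvg_gamma w0 : K w0 -> gamma w @[w --> within K (nbhs w0)] --> gamma w0.
Proof. by move: cg; rewrite subspace_continuousP; apply. Qed.

Let cvg_Phi w0 : K w0 -> Phi (gamma w) @[w --> within K (nbhs w0)] --> Phi (gamma w0).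
Proof. by move=> Kw; apply: cvg_comp (cvg_gamma Kw) (C1_continuous hPhi (x := _)). Qed.

Let cvg_diff (v : X -> X) w0 : K w0 -> v w @[w --> within K (nbhs w0)] --> v w0 ->
  'd Phi (gamma w) (v w - gamma w) @[w --> within K (nbhs w0)] -->
  'd Phi (gamma w0) (v w0 - gamma w0).
Proof.
move=> Kw cv.
apply: (@cvg_comp _ _ _ (fun w => (gamma w, v w - gamma w))
  (fun q : X * X => 'd Phi (q.1) (q.2)) _ (nbhs (gamma w0, v w0 - gamma w0))).
  by apply: cvg_pair; [exact: cvg_gamma|apply: cvgB => //; exact: cvg_gamma].
exact: (@C1_diff_continuous _ _ _ hPhi (gamma w0, v w0 - gamma w0)).
Qed.

Let near_norm (v : X -> X) w0 a : K w0 -> v w @[w --> within K (nbhs w0)] --> v w0 ->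
  `|v w0 - gamma w0| < a -> \forall w \near w0, K w -> `|v w - gamma w| < a.
Proof.
move=> Kw cv va.
have h : `|v w - gamma w| @[w --> within K (nbhs w0)] --> `|v w0 - gamma w0|.
  by apply: cvg_norm; apply: cvgB => //; exact: cvg_gamma.
exact: (cvgr_lt _ h).
Qed.

(* Targets [v w] whose linearized energy lies below [c - 2 delta]: no lower
   bound on [I (gamma w)] is needed, since [I] then decreases below a convex
   combination of [M] and [c - 2 delta]. *)
Lemma local_descent_low w0 (v : X -> X) (q : X -> R) :
  K w0 -> {within K, continuous v} -> v w0 = gamma w0 ->
  (\forall w \near w0, K w -> D w -> v w = gamma w) ->
  (\forall w \near w0, K w -> (Psi (v w) <= (q w)%:E)%E) ->
  {within K, continuous q} -> Phi (gamma w0) + q w0 < c - 2 * delta ->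
  exists2 f : X -> X, {within K, continuous f} &
    \forall w \near w0 & s \near 0^'+, K w -> descent s w (f w).
Proof.
move=> Kw cv vw0 vD vq cq low.
exists (fun w => v w - gamma w).
  move: cv cg; rewrite !subspace_continuousP => cv cg' w Kw'.
  by apply: cvgB; [exact: cv|exact: cg'].
have cvw : v w @[w --> within K (nbhs w0)] --> v w0.
  by move: cv; rewrite subspace_continuousP; apply.
have n1 : \forall w \near w0, K w -> `|v w - gamma w| < 1.
  by apply: near_norm => //; rewrite vw0 subrr normr0.
have h2 : 'd Phi (gamma w) (v w - gamma w) + q w + Phi (gamma w) @[w --> within K (nbhs w0)] -->
    'd Phi (gamma w0) (v w0 - gamma w0) + q w0 + Phi (gamma w0).
  apply: cvgD; last exact: cvg_Phi.
  by apply: cvgD; [exact: cvg_diff|move: cq; rewrite subspace_continuousP; apply].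
have n2 : \forall w \near w0, K w ->
    'd Phi (gamma w) (v w - gamma w) + q w + Phi (gamma w) < c - 2 * delta.
  by apply: (cvgr_lt _ h2); rewrite vw0 subrr linear0 add0r addrC.
apply: (near_prod (filterI (filterI n1 n2) (filterI vD vq))
  (filterI (nbhs_right_gt (0 : R)) (nbhs_right_le (ltr01 : 0 < (1 : R))))).
move=> w s [[w1 w2] [wD wq]] [/= s0 s1] Kw'.
rewrite -[X in descent _ _ X]scale1r.
apply: (@descent_target s 1 w (v w) (q w)) => //; rewrite ?mulr1 ?mul1r ?(ltW s0) ?s1 //.
- exact/ltW/w1.
- exact: wD.
- exact: wq.
have := w2 Kw'; have := Phi_p Kw'; set a := Phi (gamma w); set b := 'd Phi _ _.
move=> h3 h4.
have -> : a + p w + s * (b + q w - p w) = (1 - s) * (a + p w) + s * (b + q w + a) by ring.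
apply: (@le_trans _ _ ((1 - s) * M + s * (M - 2 * delta))); last by lra.
apply: lerD; first by rewrite ler_wpM2l // subr_ge0.
by apply: ler_wpM2l; [exact: ltW|apply: ltW; apply: lt_le_trans h4 _; rewrite lerD2r].
Qed.

(** The point [v] at which the inequality fails for [w0] serves as target for all nearby [w]. With
    [t = 1/(2d)] the direction has length one half at [w0], and the drop [4 delta d] along
    [v - gamma w0] becomes [s t 4 delta d = 2 delta s]. Only lower semicontinuity of [p] is used,
    since [p w] enters with a minus sign. *)
Lemma local_descent_high w0 : K w0 -> ~ D w0 -> ((c - 2 * delta)%:E <= I (gamma w0))%E ->
  exists2 f : X -> X, {within K, continuous f} &
    \forall w \near w0 & s \near 0^'+, K w -> descent s w (f w).
Proof.
move=> Kw nD /(no_almost_critical Kw) [v /negP]; rewrite -ltNge Psi_p // => hv.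
(* The failing inequality forces [Psi v] to be finite. *)
have [q vq hq] : exists2 q, Psi v = q%:E &
    'd Phi (gamma w0) (v - gamma w0) + q - p w0 < - (4 * delta * `|v - gamma w0|).
  move: hv; have := @Psi_ninfty v; case: (Psi v) => [r| |] // _.
  by rewrite -!EFinD lte_fin => h; exists r.
pose d := `|v - gamma w0|.
have d0 : 0 < d.
  rewrite normr_gt0 subr_eq0; apply/eqP => vg; move: hq.
  have -> : q = p w0 by apply: EFin_inj; rewrite -vq vg Psi_p.
  by rewrite vg subrr normr0 linear0 mulr0 oppr0 add0r subrr ltxx.
pose t := (2 * d)^-1.
have t0 : 0 < t by rewrite invr_gt0 mulr_gt0.
have cv : (fun=> v) @ within K (nbhs w0) --> v by exact: cvg_cst.
exists (fun w => t *: (v - gamma w)).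
  move: cg; rewrite !subspace_continuousP => cg' w Kw'.
  by apply: cvgZr; apply: cvgB; [exact: cvg_cst|exact: cg'].
have n1 : \forall w \near w0, K w -> `|v - gamma w| < 2 * d.
  by apply: (near_norm (v := fun=> v)) => //; rewrite -/d; lra.
(* Half of the strict gap, spent once on the variation of the derivative and once on that of [p]. *)
pose e := (- (4 * delta * d) - ('d Phi (gamma w0) (v - gamma w0) + q - p w0)) / 2.
have e0 : 0 < e by rewrite divr_gt0 // subr_gt0.
have n2 : \forall w \near w0, K w -> 'd Phi (gamma w) (v - gamma w) <
    'd Phi (gamma w0) (v - gamma w0) + e.
  by apply: (cvgr_lt _ (cvg_diff (v := fun=> v) Kw cv)); rewrite ltrDl.
have n3 : \forall w \near w0, K w -> p w0 - e < p w.
  have : ((p w0 - e)%:E < Psi (gamma w0))%E by rewrite Psi_p // lte_fin ltrBlDr ltrDl.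
  move=> /(Psi_near Psi_lsc) h.
  have : \forall w \near w0, K w -> ((p w0 - e)%:E < Psi (gamma w))%E := cvg_gamma Kw h.
  by apply: filterS => w hw Kw'; move: (hw Kw'); rewrite Psi_p // lte_fin.
have n4 : \forall w \near w0, ~ D w.
  by apply: open_nbhs_nbhs; split => //; exact: closed_openC.
apply: (near_prod (filterI (filterI n1 n2) (filterI n3 n4))
  (filterI (nbhs_right_gt (0 : R)) (nbhs_right_le (_ : 0 < 2 * d)))).
  by rewrite mulr_gt0.
move=> w s [[w1 w2] [w3 w4]] [/= s0 s1] Kw'.
have {}w1 := w1 Kw'; have {}w2 := w2 Kw'; have {}w3 := w3 Kw'.
apply: (@descent_target s t w v q) => //.
- exact: ltW.
- rewrite mulr_ge0 ?(ltW s0) ?(ltW t0) //=.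
  by rewrite /t ler_pdivrMr ?mulr_gt0 // mul1r.
- by rewrite /t mulrC ler_pdivrMr ?mulr_gt0 // mul1r ltW.
- exact: ltW.
- by rewrite vq.
apply: lerD; first exact: Phi_p.
have -> : - (2 * delta * s) = s * t * (- (4 * delta * d)).
  by rewrite /t; field; rewrite gt_eqF.
rewrite ler_pM2l ?mulr_gt0 //.
by move: w2 w3; rewrite /e; lra.
Qed.

Lemma local_descent w0 : K w0 ->
  exists2 f : X -> X, {within K, continuous f} &
    \forall w \near w0 & s \near 0^'+, K w -> descent s w (f w).
Proof.
move=> Kw; have [Dw|nDw] := pselect (D w0).
  (* [- Phi (rad w)] is a continuous upper bound of [Psi (rad w)], equivalent to [I (rad w) <= 0];
     at [w0] the linearized energy is thus 0, below [c - 2 delta]. *)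
  apply: (@local_descent_low w0 rad (fun w => - Phi (rad w))) => //.
  - by apply: continuous_subspaceT; exact: crad.
  - by rewrite radD // idg.
  - by near=> w => _ Dw'; rewrite radD // idg.
  - apply: filterS (I_rad Dw) => w h /h; rewrite -[0%E]/(0%:E) I_le.
    by rewrite sub0r.
  - apply: continuous_subspaceT => w; apply: cvgN.
    by apply: continuous_comp; [exact: crad|exact: C1_continuous].
  - by rewrite radD // idg // subrr subr_gt0.
have [hi|] := boolP ((c - 2 * delta)%:E <= I (gamma w0))%E.
  exact: local_descent_high.
rewrite -ltNge => lo.
(* The target is the constant [gamma w0] rather than [gamma w]: [Psi] may jump up along [gamma],
   while [p w0] stays fixed. *)
apply: (@local_descent_low w0 (fun=> gamma w0) (fun=> p w0)) => //.
- by apply: continuous_subspaceT => w; exact: cvg_cst.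
- have n4 : \forall w \near w0, ~ D w.
    by apply: open_nbhs_nbhs; split => //; exact: closed_openC.
  by apply: filterS n4 => w nD _ /nD.
- by near=> w => _; rewrite Psi_p.
- by apply: continuous_subspaceT => w; exact: cvg_cst.
- by move: lo; rewrite /I /functional Psi_p // -EFinD lte_fin.
Unshelve. all: end_near. Qed.

(** The uniform expansion of [Phi] on the compact image of [gamma], with error [delta |h|], converts
    the linearized decrease [2 delta s] into a true decrease [delta s]. *)
Lemma deformation : exists eta, [/\ finite_maps eta, below eta gamma & level eta < level gamma].
Proof.
have [F cF hF] := convex_glue cK descent_convex local_descent.
have cA : compact (gamma @` K) by exact: continuous_compact.
have hU := C1_uniform hPhi cA delta0.
have [s [s0 [sF sU]]] := filter_ex (filterI (nbhs_right_gt (0 : R)) (filterI hF hU)).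
pose eta0 w := gamma w + s *: F w.
have c0 : {within K, continuous eta0}.
  move: cg cF; rewrite !subspace_continuousP => cg' cF' w Kw.
  by apply: cvgD; [exact: cg'|apply: cvgZr; exact: cF'].
pose eta := average mu act eta0.
have Kact' g w : K w -> K (act g w) by exact: K_act.
(* The descent bound rewritten in terms of the endpoint [x] instead of the direction: it is affine
   in [x], so the corresponding condition on [Psi] is closed and convex. *)
pose b w x := M - 2 * delta * s - Phi (gamma w) - 'd Phi (gamma w) (x - gamma w).
have key w : K w -> `|gamma w - eta w| <= s /\ (Psi (eta w) <= (b w (eta w))%:E)%E.
  move=> Kw.
  apply: (average_closed_convex (C := [set x | `|gamma w - x| <= s /\ (Psi x <= (b w x)%:E)%E])
    mu cG actP Kact' c0 Kw).
  - apply: closedI; first exact: ball_closed.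
    apply: sublevel_closed => // x; apply: cvgB; first exact: cvg_cst.
    apply: (@continuous_comp _ _ _ (fun x => x - gamma w) ('d Phi (gamma w))).
      by apply: cvgB; [exact: cvg_id|exact: cvg_cst].
    by apply: diff_continuous; exact: hPhi.1.
  - move=> x y a [xs xP] [ys yP] a01; split; first exact: ball_convex.
    have := @sublevel_convex _ _ Psi Psi_convex (b w) _ x y a xP yP a01; apply.
    move=> x' y' a'; rewrite /b.
    have -> : a' *: x' + (1 - a') *: y' - gamma w =
        a' *: (x' - gamma w) + (1 - a') *: (y' - gamma w).
      rewrite !scalerBr addrACA; congr (_ + _).
      by rewrite -opprD -scalerDl subrKC scale1r.
    by rewrite linearD !linearZ /= !/(_ *: _) /=; ring.
  (* The descent property is used at [w' = g^-1 w] and carried back to [w] by invariance of [Phi],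
     [Psi] and the norm. *)
  - move=> g /=; set w' := act g^-1%g w.
    have Kw' : K w' by exact: K_act.
    have ww' : w = act g w' by rewrite /w' actVK.
    have [F1 _ FP] := sF w' Kw'.
    rewrite ww' eg // act_dist // /eta0 opprD addrA subrr sub0r normrN normrZ gtr0_norm //.
    split; first by rewrite ler_piMr // ltW.
    rewrite Psi_inv; apply: le_trans FP _; rewrite lee_fin /b.
    rewrite eg // Phi_inv -(linear_funB _ _ (act_linear actP g)) diff_invariant //;
      last exact: act_linear.
    have -> : gamma w' + s *: F w' - gamma w' = s *: F w' by rewrite [gamma w' + _]addrC addrK.
    have -> // : 'd Phi (gamma w') (s *: F w') = s * 'd Phi (gamma w') (F w').
    exact: linearZ.
have Eeta : equivariant_maps eta.
  split.
  - by apply: (average_continuous cG actP isoP Kact' c0); exact: compact_uniform.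
  - exact: (average_equivariant cG hmu actP isoP Kact' c0).
  - move=> w Dw; apply: (average_closed_convex (C := [set w]) mu cG actP Kact' c0 (DK Dw)).
    + exact: closed_singleton.
    + by move=> x y a -> -> _; rewrite /= -scalerDl subrKC scale1r.
    + move=> g /=; rewrite /eta0; have Dw' := D_act g^-1%g Dw.
      have [_ -> // _] := sF _ (DK Dw').
      by rewrite scaler0 addr0 idg // actVK.
have [feta leta] : finite_maps eta /\ level eta <= M - delta * s.
  apply: level_le => // w Kw; rewrite I_le; have [ws wP] := key w Kw.
  apply: le_trans wP _; rewrite lee_fin /b.
  have Aw : (gamma @` K) (gamma w) by exists w.
  have := sU _ Aw (eta w - gamma w); rewrite distrC => /(_ ws).
  rewrite [gamma w + _]addrC subrK => /ler_normlP [_].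
  have : delta * `|gamma w - eta w| <= delta * s by rewrite ler_pM2l.
  lra.
exists eta; split => //.
- move=> w Kw; have [ws _] := key w Kw.
  rewrite distrC; apply: (@le_trans _ _ (delta * s)); first by rewrite ler_pM2l.
  by move: leta; rewrite -/M; lra.
- by apply: le_lt_trans leta _; rewrite ltrBlDr ltrDl mulr_gt0.
Qed.

End Deformation.

(** The ordering principle starts from a map of level at most [c + delta], which bounds [I u] from
    above; without a suitable [u] on its image, [deformation] would contradict the minimality of the
    map obtained. *)
Lemma almost_critical : exists u, [/\ ((c - 2 * delta)%:E <= I u)%E,
  (I u <= (c + delta)%:E)%E &
  forall v, ((- (4 * delta * `|v - u|))%R%:E <=
     ('d Phi u (v - u)%R)%:E + Psi v - Psi u)%E].
Proof.
have [gamma0 fg0 g0] : exists2 gamma, finite_maps gamma & level gamma <= c + delta.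
  have : (ereal_inf [set sup_level gamma | gamma in equivariant_maps] < (c + delta)%:E)%E.
    by rewrite c_inf lte_fin ltrDl.
  move=> /ereal_inf_lt [_ [gamma Eg <-] ls].
  have fg : finite_maps gamma by split => //; apply: lt_trans ls _; rewrite ltry.
  by exists gamma => //; move: ls; rewrite levelE // lte_fin => /ltW.
have [||||gamma [fg gg0 gmin]] := @order_minimal R (X -> X) finite_maps
  (fun gamma eta => below gamma eta) level c _ _ _ _ below_limit gamma0 fg0.
- by move=> x _ w _; rewrite !subrr normr0 mulr0.
- by move=> x y z; exact: below_trans.
- by move=> x y _ _; exact: below_level.
- by move=> x; exact: c_le_level.
apply: contrapT => nex.
have [w Kw hw|eta [feta beta leta]] := deformation fg.
  apply: contrapT => nv; apply: nex; exists (gamma w); split => //.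
    apply: le_trans (I_le_level fg Kw) _; rewrite lee_fin.
    by apply: le_trans (below_level gg0) g0.
  by move=> v; apply/negPn/negP => hv; apply: nv; exists v; exact/negP.
by move: leta; rewrite (gmin eta feta beta) ltxx.
Qed.

End Minimax.

(** * Critical points at the levels c_k *)

(** Lower semicontinuity alone gives [I v <= c]. Equality comes from testing the inequality at
    [w = v], which bounds [Psi (u n)] by [Psi v] plus a term tending to 0. *)
Lemma limit_critical (R : realType) (X : normedModType R) (Phi : X -> R)
    (Psi : X -> \bar R) (c : R) (u : nat -> X) (v : X) (eps : nat -> R) :
  C1_functional Phi -> (forall u, Psi u <> -oo%E) -> lower_semicontinuous Psi ->
  u n @[n --> \oo] --> v -> eps n @[n --> \oo] --> (0 : R) ->
  functional Phi Psi (u n) @[n --> \oo] --> c%:E ->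
  (forall n w, ((- (eps n * `|w - u n|))%R%:E
          <= ('d Phi (u n) (w - u n)%R)%:E + Psi w - Psi (u n))%E) ->
  critical_point Phi Psi v /\ functional Phi Psi v = c%:E.
Proof.
move=> hPhi Pn Pl cu ceps cI hu.
have cI_lt a : c < a -> \forall n \near \oo, (functional Phi Psi (u n) < a%:E)%E.
  by move=> ca; exact: (cI _ (nbhs_open_ereal_lt (f := fun=> a) ca)).
have cI_gt a : a < c -> \forall n \near \oo, (a%:E < functional Phi Psi (u n))%E.
  by move=> ca; exact: (cI _ (nbhs_open_ereal_gt (f := fun=> a) ca)).
have cPhi : Phi (u n) @[n --> \oo] --> Phi v.
  exact: cvg_comp cu (@C1_continuous _ _ _ hPhi v).
have cd w : 'd Phi (u n) (w - u n) + eps n * `|w - u n| @[n --> \oo] --> 'd Phi v (w - v).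
  have -> : 'd Phi v (w - v) = 'd Phi v (w - v) + 0 * `|w - v| by rewrite mul0r addr0.
  have cw : w - u n @[n --> \oo] --> w - v by apply: cvgB; [exact: cvg_cst|exact: cu].
  apply: cvgD; last by apply: cvgM => //; apply: cvg_norm.
  apply: (@cvg_comp _ _ _ (fun n => (u n, w - u n))
    (fun q : X * X => 'd Phi (q.1) (q.2)) _ (nbhs (v, w - v))).
    exact: cvg_pair.
  exact: (@C1_diff_continuous _ _ _ hPhi (v, w - v)).
have Psi_u w (q : R) n : Psi w = q%:E ->
    (Psi (u n) <= ('d Phi (u n) (w - u n) + eps n * `|w - u n| + q)%:E)%E.
  move=> wq; have := hu n w; rewrite wq; have := @Pn (u n).
  case: (Psi (u n)) => [r| |] // _.
  by rewrite -!EFinD !lee_fin; lra.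
have lev : (functional Phi Psi v <= c%:E)%E.
  rewrite leNgt; apply/negP => cv.
  have [a ca av] := functional_between Pn cv.
  have h1 : \forall n \near \oo, (a%:E < functional Phi Psi (u n))%E :=
    cu _ (functional_near Pn Pl (C1_continuous hPhi) av).
  have [n [h2 h3]] := filter_ex (filterI h1 (cI_lt a ca)).
  by move: h2; rewrite /= ltNge (ltW h3).
have Pv : Psi v = (fine (Psi v))%:E.
  by move: lev; rewrite functional_le //; exact: Psi_fine.
have crit w (q : R) : Psi w = q%:E -> fine (Psi v) <= 'd Phi v (w - v) + q.
  move=> wq; rewrite leNgt; apply/negP => lt.
  pose a := (('d Phi v (w - v) + q) + fine (Psi v)) / 2.
  have av : (a%:E < Psi v)%E by rewrite Pv lte_fin /a; lra.
  have h1 : \forall n \near \oo, (a%:E < Psi (u n))%E := cu _ (Psi_near Pl av).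
  have h2 : \forall n \near \oo, 'd Phi (u n) (w - u n) + eps n * `|w - u n| < a - q.
    by apply: (cvgr_lt _ (cd w)); rewrite /a; lra.
  have [n [h3 h4]] := filter_ex (filterI h1 h2).
  move: h3; rewrite /= ltNge => /negP; apply; apply: le_trans (Psi_u w q n wq) _.
  by rewrite lee_fin -lerBrDr ltW.
have fv : functional Phi Psi v = (Phi v + fine (Psi v))%:E by rewrite /functional Pv.
have cle : c <= Phi v + fine (Psi v).
  rewrite leNgt; apply/negP => lt.
  pose a := (Phi v + fine (Psi v) + c) / 2.
  have ac : a < c by rewrite /a; lra.
  have cs : Phi (u n) + ('d Phi (u n) (v - u n) + eps n * `|v - u n|) @[n --> \oo]
      --> Phi v + 'd Phi v (v - v).
    by apply: cvgD => //; exact: cd.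
  have h2 : \forall n \near \oo,
      Phi (u n) + ('d Phi (u n) (v - u n) + eps n * `|v - u n|) < a - fine (Psi v).
    by apply: (cvgr_lt _ cs); rewrite subrr linear0 addr0 /a; lra.
  have [n [h3 h4]] := filter_ex (filterI (cI_gt a ac) h2).
  move: h3; rewrite /= ltNge functional_le // => /negP; apply.
  apply: le_trans (Psi_u v _ n Pv) _.
  by rewrite lee_fin; move: h4; rewrite /=; lra.
have ceq : functional Phi Psi v = c%:E.
  by apply/eqP; rewrite eq_le lev fv lee_fin.
split => //; split; first by rewrite ceq ltry.
move=> w; have := @Pn w; case Pw : (Psi w) => [q| |] // _.
  by rewrite Pv -!EFinD lee_fin; have := crit w q Pw; lra.
by rewrite Pv addey // addye // leey.
Qed.

Lemma subsequence_cvg (phi : nat -> nat) : {homo phi : m n / (m < n)%N} ->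
  phi n @[n --> \oo] --> \oo.
Proof.
move=> hphi; have le n : (n <= phi n)%N.
  by elim: n => // n IH; apply: leq_ltn_trans IH _; exact: hphi.
move=> A [N _ NA]; exists N => // n /= Nn; apply: NA => /=.
exact: leq_trans Nn (le n).
Qed.

Section Fountain.
Variables (R : realType) (X : completeNormedModType R)
    (G : topologicalGroupType) (act : G -> X -> X) (Xs : nat -> set X)
    (mu : probability (borel G) R) (Phi : X -> R) (Psi : X -> \bar R)
    (rho r : nat -> R).
Hypotheses (hG0 : condition_G0 act Xs)
    (hmu : is_haar mu)
    (hPhi : C1_functional Phi)
    (hPsi_ninfty : forall u, Psi u <> -oo%E)
    (hPsi_convex : ereal_convex Psi)
    (hPsi_lsc : lower_semicontinuous Psi)
    (hPS : Palais_Smale_condition Phi Psi)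
    (hPhi_inv : invariant_functional act Phi)
    (hPsi_inv : invariant_functional act Psi)
    (hr : forall k, (1 <= k)%N -> 0 < r k < rho k).

Lemma b_le_c k : (2 <= k)%N ->
  (b_ Xs r (functional Phi Psi) k <= c_ act Xs rho (functional Phi Psi) k)%E.
Proof.
move=> k2; apply: le_ereal_inf_tmp => _ [gamma Tg <-].
have [V [actV [f hf]]] := isotypic_exists hG0.
have [w [Bw Zw gw]] := intersection hG0 hmu hf k2 (hr (ltnW k2)) Tg.
apply: (@le_trans _ _ (functional Phi Psi (gamma w))).
  by apply: ereal_inf_lbound; exists (gamma w).
by apply: ereal_sup_ubound; exists w.
Qed.

(** Positivity of [c] separates the level from the values of [I] on the sphere, at most 0, and
    leaves room for [2 delta < c]. *)
Lemma critical_level k (c : R) : (2 <= k)%N ->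
  (a_ Xs rho (functional Phi Psi) k <= 0)%E ->
  c_ act Xs rho (functional Phi Psi) k = c%:E -> 0 < c ->
  exists u, critical_point Phi Psi u /\ functional Phi Psi u = c%:E.
Proof.
move=> k2 ak ck c0.
have [cG actP isoP _ _] := hG0.
have [V [actV [f hf]]] := isotypic_exists hG0.
have /andP[rk0 rkrho] := hr (ltnW k2).
have rho0 : 0 < rho k by exact: lt_trans rkrho.
(* The maximum with [rho k / 2] keeps the map continuous at 0; beyond norm [rho k / 2] it is the
   radial projection. *)
pose rad (w : X) := (rho k / Num.max `|w| (rho k / 2)) *: w.
have max0 (w : X) : 0 < Num.max `|w| (rho k / 2) by rewrite lt_max divr_gt0 ?orbT.
have crad : continuous rad.
  move=> w; apply: cvgZ; last exact: cvg_id.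
  apply: cvgM; first exact: cvg_cst.
  apply: cvgV; first by rewrite gt_eqF.
  apply: (@continuous_max _ _ (fun w : X => `|w|) (fun=> rho k / 2) w).
    exact: norm_continuous.
  exact: cvg_cst.
have radD w : dB_ Xs rho k w -> rad w = w.
  move=> [_ nw]; rewrite /rad nw max_l; last by rewrite ler_pdivrMr //; lra.
  by rewrite divff ?scale1r // gt_eqF.
have I_rad w0 : dB_ Xs rho k w0 -> \forall w \near w0, B_ Xs rho k w ->
    (functional Phi Psi (rad w) <= 0)%E.
  move=> [_ nw0].
  have : \forall w \near w0, rho k / 2 < `|w|.
    by apply: (cvgr_gt _ (@norm_continuous _ _ w0)); rewrite nw0; lra.
  apply: filterS => w wr [Yw _]; apply: le_trans ak.
  apply: ereal_sup_ubound; exists (rad w) => //; split.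
    by apply: subspaceZ => //; exact: (Y_subspace hG0).
  have w0' : 0 < `|w| by apply: lt_trans wr; rewrite divr_gt0.
  rewrite /rad max_l ?(ltW wr) // normrZ ger0_norm ?divr_ge0 ?ltW //.
  by rewrite divfK // gt_eqF.
have DK : dB_ Xs rho k `<=` B_ Xs rho k by move=> w [Yw nw]; split => //; rewrite nw.
have cD : closed (dB_ Xs rho k).
  have -> : dB_ Xs rho k = Y_ Xs k `&` (fun w => `|w|) @^-1` [set rho k] by [].
  apply: closedI; first exact: (Y_closed hG0 hf).
  by apply: closed_comp => [w _|]; [exact: norm_continuous|exact: closed_eq].
have D_act g w : dB_ Xs rho k w -> dB_ Xs rho k (act g w).
  by move=> [Yw nw]; split; [exact: (Y_act hG0)|rewrite isoP].
(* With [delta = c / (4 (n+1))], [2 delta] is at most [c / 2], and the slope [4 delta = c / (n+1)]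
   tends to 0. *)
have AC n := @almost_critical R X G mu act Phi Psi cG hmu actP isoP hPhi hPsi_ninfty
  hPsi_convex hPsi_lsc hPhi_inv hPsi_inv _ _ rad (@B_compact _ _ _ _ _ hG0 _ _ _ hf rho k)
  (fun g w => @B_act _ _ _ _ _ hG0 rho k g w) DK cD D_act crad radD I_rad c ck
  (c / (4 * n.+1%:R)).
have d0 n : 0 < c / (4 * n.+1%:R) by rewrite divr_gt0 // mulr_gt0.
have dc n : 2 * (c / (4 * n.+1%:R)) < c.
  have n1 : 1 <= n.+1%:R :> R by rewrite ler1n.
  have : c / (4 * n.+1%:R) <= c / 4.
    by rewrite ler_pM2l // lef_pV2 ?posrE ?mulr_gt0 // ler_pMr.
  by set x := c / (4 * n.+1%:R); lra.
have [u hu] := choice (fun n => AC n (d0 n) (dc n)).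
have cd : c / (4 * n.+1%:R) @[n --> \oo] --> (0 : R).
  have -> : (fun n => c / (4 * n.+1%:R)) = (fun n : nat => (c / 4) * n.+1%:R^-1).
    by apply/funext => n; rewrite invfM mulrA.
  rewrite -(mulr0 (c / 4)); apply: cvgM; first exact: cvg_cst.
  exact: cvg_harmonic.
have cIu : functional Phi Psi (u n) @[n --> \oo] --> c%:E.
  apply: (@squeeze_cvge _ _ _ _ (fun n => (c - 2 * (c / (4 * n.+1%:R)))%:E) _
    (fun n => (c + c / (4 * n.+1%:R))%:E)).
  - by apply: nearW => n; have [-> -> _] := hu n.
  - apply: cvg_EFin; first exact: nearW.
    rewrite -[X in _ --> X]subr0 -(mulr0 2); apply: cvgB; first exact: cvg_cst.
    by apply: cvgM; [exact: cvg_cst|exact: cd].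
  - apply: cvg_EFin; first exact: nearW.
    by rewrite -[X in _ --> X]addr0; apply: cvgD; [exact: cvg_cst|exact: cd].
have ceps : 4 * (c / (4 * n.+1%:R)) @[n --> \oo] --> (0 : R).
  by rewrite -(mulr0 4); apply: cvgM; [exact: cvg_cst|exact: cd].
have PSu : Palais_Smale_sequence Phi Psi c u.
  split => //; exists (fun n => 4 * (c / (4 * n.+1%:R))); split => //.
  - by move=> n; rewrite mulr_gt0.
  - by move=> n v; have [_ _ /(_ v)] := hu n.
have [phi [hphi cvu]] := hPS PSu.
have cphi := subsequence_cvg hphi.
exists (lim (u (phi n) @[n --> \oo])).
apply: (@limit_critical _ _ Phi Psi c (u \o phi) _
  (fun n => 4 * (c / (4 * (phi n).+1%:R)))) => //.
- exact: (cvg_comp _ _ cphi ceps).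
- exact: (cvg_comp _ _ cphi cIu).
- by move=> n v; have [_ _ /(_ v)] := hu (phi n).
Qed.

End Fountain.

Lemma finite_range_bounded (T : eqType) (R : realType) (F : T -> \bar R) (s : seq T) :
  (forall x, x \in s -> (F x < +oo)%E) ->
  exists M : R, forall x, x \in s -> (F x <= M%:E)%E.
Proof.
elim: s => [_|x s IH h]; first by exists 0.
have [|M hM] := IH; first by move=> y ys; apply: h; rewrite in_cons ys orbT.
have : (F x < +oo)%E by apply: h; rewrite mem_head.
case Fx : (F x) => [q| |] // _.
  exists (Num.max q M) => y; rewrite in_cons => /predU1P[->|/hM yM].
    by rewrite Fx lee_fin le_max lexx.
  by apply: le_trans yM _; rewrite lee_fin le_max lexx orbT.
exists M => y; rewrite in_cons => /predU1P[->|/hM //].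
by rewrite Fx leNye.
Qed.

Theorem theorem3p6 (R : realType) (X : completeNormedModType R)
    (G : topologicalGroupType) (act : G -> X -> X) (Xs : nat -> set X)
    (mu : probability (borel G) R) (Phi : X -> R) (Psi : X -> \bar R)
    (rho r : nat -> R)
    (hG0 : condition_G0 act Xs)
    (hmu : is_haar mu)
    (hPhi : C1_functional Phi)
    (hPsi_ninfty : forall u, Psi u <> -oo%E)
    (hPsi_convex : ereal_convex Psi)
    (hPsi_lsc : lower_semicontinuous Psi)
    (hPsi_proper : exists u, Psi u <> +oo%E)
    (hPS : Palais_Smale_condition Phi Psi)
    (hPhi_inv : invariant_functional act Phi)
    (hPsi_inv : invariant_functional act Psi)
    (hPsi_compat : compatible mu act Psi)
    (hr : forall k, (1 <= k)%N -> 0 < r k < rho k)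
    (ha : forall k, (2 <= k)%N -> (a_ Xs rho (functional Phi Psi) k <= 0)%E)
    (hb : b_ Xs r (functional Phi Psi) k @[k --> \oo] --> +oo%E)
    (hc : forall k, (2 <= k)%N ->
       (c_ act Xs rho (functional Phi Psi) k < +oo)%E) :
  exists (k0 : nat) (u : nat -> X),
    [/\ forall k, (k0 <= k)%N -> critical_point Phi Psi (u k) /\
          functional Phi Psi (u k) = c_ act Xs rho (functional Phi Psi) k,
        infinite_set [set u k | k in [set k | (k0 <= k)%N]] &
        c_ act Xs rho (functional Phi Psi) k @[k --> \oo] --> +oo%E].
Proof.
have bc k : (2 <= k)%N ->
    (b_ Xs r (functional Phi Psi) k <= c_ act Xs rho (functional Phi Psi) k)%E.
  by move=> k2; exact: (b_le_c Phi Psi hG0 hmu hr k2).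
have c_infty : c_ act Xs rho (functional Phi Psi) k @[k --> \oo] --> +oo%E.
  apply/cvgeyPge => A; have /cvgeyPge /(_ A) h := hb.
  near=> k; apply: (@le_trans _ _ (b_ Xs r (functional Phi Psi) k)).
    by near: k.
  by apply: bc; near: k; exact: nbhs_infty_ge.
(* Positivity of the levels is only eventual; with the bound 2 it determines [k0]. *)
have [N _ hN] : \forall k \near \oo, (0 < c_ act Xs rho (functional Phi Psi) k)%E.
  by have /cvgeyPgt /(_ 0) := c_infty.
have q k : exists u, (maxn 2 N <= k)%N -> critical_point Phi Psi u /\
    functional Phi Psi u = c_ act Xs rho (functional Phi Psi) k.
  have [|_] := leqP (maxn 2 N) k; last by exists 0.
  rewrite geq_max => /andP[k2 Nk].
  have := hN k Nk; have := hc k k2.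
  case ck : (c_ _ _ _ _ k) => [c| |] // _; rewrite /= lte_fin => c0.
  have [u hu] := critical_level hG0 hmu hPhi hPsi_ninfty hPsi_convex hPsi_lsc
    hPS hPhi_inv hPsi_inv hr k2 (ha k k2) ck c0.
  by exists u.
have [u hu] := choice q.
exists (maxn 2 N), u; split => //.
move=> /finite_seqP [s hs].
(* On finitely many critical points [I] would be bounded, whereas the levels are unbounded. *)
have [M hM] : exists M : R, forall x, x \in s -> (functional Phi Psi x <= M%:E)%E.
  apply: finite_range_bounded => x xs.
  have : [set` s] x by [].
  by rewrite -hs => -[k /= /hu [[]]] + _ _ <-.
have /cvgeyPgt /(_ M) [N' _ hN'] := c_infty.
pose k := maxn N' (maxn 2 N).
have kN : (maxn 2 N <= k)%N by rewrite leq_maxr.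
have [_ uk] := hu k kN.
have us : u k \in s.
  have : [set` s] (u k) by rewrite -hs; exists k.
  by [].
have := hN' k (leq_maxl _ _); rewrite /= -uk ltNge => /negP; apply.
exact: hM.
Unshelve. all: end_near. Qed.
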